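(* Let $H$ be a finite-dimensional semisimple Hopf algebra over an algebraically closed field $k$ of characteristic $0$, and use the notation of the context. For each $j$, the irreducible character $\mu_j$ of the algebra $R(H)$ afforded by the irreducible right $R(H)$-module $f_jR(H)$ is given by $\eta_j$: for every $x\in R(H)$, the trace of the linear map $f_jR(H)\to f_jR(H)$, $y\mapsto yx$, equals $\langle x,\eta_j\rangle$. In particular $\langle \varepsilon,\eta_j\rangle=m_j$.
   Context: $d=\dim H$; $H^*$ is the dual Hopf algebra with antipode $s$. $\Lambda\in H$ is the (two-sided) integral of $H$ and $\lambda\in H^*$ the integral of $H^*$, normalized so $\langle\lambda,\Lambda\rangle=1$. For $h\in H$, $p\in H^*$, define $h\leftharpoonup p=\sum\langle p,h_1\rangle h_2$ (so $\langle q,h\leftharpoonup p\rangle=\langle pq,h\rangle$). Let $V_0=k,\dots,V_{n-1}$ be the non-isomorphic irreducible left $H$-modules with characters $\chi_0=\varepsilon,\dots,\chi_{n-1}$ and $d_i=\dim V_i=\langle\chi_i,1\rangle$. $R(H)\subset H^*$ is the span of the $\chi_i$ (the character algebra; it is semisimple). Let $F_0=\frac1d\lambda,F_1,\dots,F_{m-1}$ be the central primitive idempotents of $R(H)$; for each $j$ fix a primitive idempotent $f_j\in R(H)$ with $f_jF_j=f_j$, and let $m_j=\dim f_jR(H)$. Set $C_j=\Lambda\leftharpoonup dF_j$ and $\eta_j=\frac{1}{\dim(f_jH^* )}C_j$ (normalized class sum). *)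

(* Defs.v *)
(* A finite-dimensional Hopf algebra H of dimension d over a
   field k is presented in coordinates w.r.t. a basis e_0..e_{d-1}:
   H = 'rV[k]_d, H^* = 'rV[k]_d (dual basis), <p,h> = sum_i p_i h_i. *)
From HB Require Import structures.
From mathcomp Require Import all_boot all_order all_algebra all_field.
Set Implicit Arguments. Unset Strict Implicit. Unset Printing Implicit Defensive.
Import Order.TTheory GRing.Theory Num.Theory.
Local Open Scope ring_scope.

(* structure constants:
   e_i e_j = sum_l hmu i j l e_l ;  1_H = hunit ;
   Delta(e_l) = sum_{i,j} hdelta l i j e_i (x) e_j ;  eps(e_i) = hcounit_i ;
   S(e_i) = row i of hanti. *)
Record hopf_data (k : fieldType) (d : nat) := HopfData {
  hmu : 'I_d -> 'I_d -> 'I_d -> k;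
  hunit : 'rV[k]_d;
  hdelta : 'I_d -> 'I_d -> 'I_d -> k;
  hcounit : 'rV[k]_d;
  hanti : 'M[k]_d }.

Section Hopf.
Variables (k : fieldType) (d : nat) (D : hopf_data k d).

Definition hpair (p h : 'rV[k]_d) : k := \sum_i p 0 i * h 0 i.

Definition hmul (a b : 'rV[k]_d) : 'rV[k]_d :=
  \row_l \sum_i \sum_j a 0 i * b 0 j * hmu D i j l.

(* multiplication of H^* (convolution): <pq, h> = sum <p,h1><q,h2> *)
Definition hconv (p q : 'rV[k]_d) : 'rV[k]_d :=
  \row_l \sum_i \sum_j hdelta D l i j * p 0 i * q 0 j.

(* Delta(a) as an element of H (x) H, coordinates w.r.t. e_i (x) e_j *)
Definition hDelta (a : 'rV[k]_d) : 'M[k]_d :=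
  \matrix_(i, j) \sum_l a 0 l * hdelta D l i j.

Definition tmul (T T' : 'M[k]_d) : 'M[k]_d :=
  \matrix_(l, m) \sum_i \sum_j \sum_i' \sum_j'
     T i j * T' i' j' * hmu D i i' l * hmu D j j' m.

Definition hS (a : 'rV[k]_d) : 'rV[k]_d := a *m hanti D.

Definition hbasis (i : 'I_d) : 'rV[k]_d := delta_mx 0 i.

Definition is_hopf : Prop :=
  (forall a b c, hmul (hmul a b) c = hmul a (hmul b c)) /\
      (forall a, hmul (hunit D) a = a /\ hmul a (hunit D) = a) /\
      (* coassociativity and counit, stated dually *)
      (forall p q r, hconv (hconv p q) r = hconv p (hconv q r)) /\
      (forall p, hconv (hcounit D) p = p /\ hconv p (hcounit D) = p) /\
      ((forall a b, hDelta (hmul a b) = tmul (hDelta a) (hDelta b))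
      /\ hDelta (hunit D) = \matrix_(i, j) (hunit D 0 i * hunit D 0 j)) /\
      ((forall a b, hpair (hcounit D) (hmul a b)
                   = hpair (hcounit D) a * hpair (hcounit D) b)
      /\ hpair (hcounit D) (hunit D) = 1) /\
      (forall a,
        \sum_i \sum_j hDelta a i j *: hmul (hS (hbasis i)) (hbasis j)
          = hpair (hcounit D) a *: hunit D
     /\ \sum_i \sum_j hDelta a i j *: hmul (hbasis i) (hS (hbasis j))
          = hpair (hcounit D) a *: hunit D).

Definition left_ideal (U : {vspace 'rV[k]_d}) : Prop :=
  forall a b, b \in U -> hmul a b \in U.

Definition semisimple : Prop :=
  forall U, left_ideal U ->
    exists V, [/\ left_ideal V, (U + V = fullv)%VS & (U :&: V = 0)%VS].

Definition is_integral_H (L : 'rV[k]_d) : Prop :=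
  forall h, hmul h L = hpair (hcounit D) h *: L /\
            hmul L h = hpair (hcounit D) h *: L.
Definition is_integral_Hdual (l : 'rV[k]_d) : Prop :=
  forall p, hconv p l = hpair p (hunit D) *: l /\
            hconv l p = hpair p (hunit D) *: l.

Definition hact n (rho : 'I_d -> 'M[k]_n) (h : 'rV[k]_d) : 'M[k]_n :=
  \sum_i h 0 i *: rho i.

Definition is_lmod n (rho : 'I_d -> 'M[k]_n) : Prop :=
  (forall a b, hact rho (hmul a b) = hact rho a *m hact rho b) /\
  hact rho (hunit D) = 1%:M.

(* H acts on column vectors v |-> rho(h) v; a subspace of k^n is given by the
   row space of W, whose rows are the transposed vectors *)
Definition lmod_irreducible n (rho : 'I_d -> 'M[k]_n) : Prop :=
  (0 < n)%N /\
  forall W : 'M[k]_n, (forall h, (W *m (hact rho h)^T <= W)%MS) ->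
    W = 0 \/ row_full W.

Definition lmod_iso n1 n2 (rho1 : 'I_d -> 'M[k]_n1) (rho2 : 'I_d -> 'M[k]_n2) :
  Prop :=
  exists P : 'M[k]_(n1, n2), [/\ row_free P, row_full P &
     forall h, hact rho1 h *m P = P *m hact rho2 h].

Definition hchar n (rho : 'I_d -> 'M[k]_n) : 'rV[k]_d := \row_i \tr (rho i).

(* h <- p = sum <p,h1> h2 *)
Definition hit (h p : 'rV[k]_d) : 'rV[k]_d :=
  \row_j \sum_m \sum_i h 0 m * hdelta D m i j * p 0 i.

Definition sub_trace (U : {vspace 'rV[k]_d}) (g : 'rV[k]_d -> 'rV[k]_d) : k :=
  \sum_(i < \dim U) coord (vbasis U) i (g (vbasis U)`_i).

Section CharAlg.
(* the character algebra R(H), spanned by a list of irreducible characters *)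
Variable RH : {vspace 'rV[k]_d}.

Definition idem (x : 'rV[k]_d) := hconv x x = x.
Definition central_in (x : 'rV[k]_d) := forall y, y \in RH -> hconv x y = hconv y x.

Definition central_primitive_idem (F : 'rV[k]_d) : Prop :=
  [/\ F \in RH, F != 0, idem F, central_in F &
      forall F1 F2, F1 \in RH -> F2 \in RH -> idem F1 -> idem F2 ->
        central_in F1 -> central_in F2 -> F1 != 0 -> F2 != 0 ->
        hconv F1 F2 = 0 -> hconv F2 F1 = 0 -> F <> F1 + F2].

Definition primitive_idem (f : 'rV[k]_d) : Prop :=
  [/\ f \in RH, f != 0, idem f &
      forall f1 f2, f1 \in RH -> f2 \in RH -> idem f1 -> idem f2 ->
        f1 != 0 -> f2 != 0 ->
        hconv f1 f2 = 0 -> hconv f2 f1 = 0 -> f <> f1 + f2].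
End CharAlg.

End Hopf.

(* Main.v *)
(* Integrals make H a Frobenius algebra: [lam (a b) = lam (b S^2(a)) =
   lam (S^2(b) a)], hence [S^4 = 1], and the trace of [S^2] composed with
   multiplication by [p] on H^* is [<p, Lam> <lam, 1>]. The regular character
   divided by d is an idempotent of H^* fixed by [S^2]; as traces of involutions
   commuting with idempotents are integers, [tr S^2] is a nonzero multiple of d,
   and [S^2 = 1] follows (Larson-Radford). So [p |-> d <p, Lam>] is the trace of
   the regular representation of H^*, and the orthogonality relations make the
   form [<x y, Lam>] nondegenerate on R(H).

   Nilpotents have trace 0, so every nonzero right ideal of R(H) inside f R(H)
   contains f, and f R(H) f = k f by Schur's lemma. With a basis [u_i] of f R(H)
   and the dual family [v_i] in R(H) f, the element [P = <f, Lam> sum v_i u_i] is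
   a central idempotent, hence [P = F], and the trace of [y |-> y x] on f R(H)
   is [sum <u_i x v_i, Lam> = <F x, Lam> / <f, Lam>], where
   [d <f, Lam> = dim f H^*]. *)
Require Import Defs.
From HB Require Import structures.
From Stdlib Require Import Classical_Prop.
From mathcomp Require Import all_boot all_order all_algebra all_field.
From mathcomp Require Import zify ring mxtens.
Set Implicit Arguments. Unset Strict Implicit. Unset Printing Implicit Defensive.
Import GRing.Theory.
Local Open Scope ring_scope.

(** * Linear maps and Sweedler sums *)

Section Multilinear.
Variables (k : fieldType) (d : nat).
Local Notation H := 'rV[k]_d.
Implicit Types (a b p q : H).

(** The obstacle is that no Wedderburn decomposition of [R(H)] is at hand. Its substitute is the
    single functional [<_, Lam>], which has two faces: up to the factor [d] it is a regular trace,
    so it kills nilpotents and computes dimensions; and it is nondegenerate on [R(H)], so dual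
    families exist. Both faces rest on [S^2 = 1]: the first because the trace formula for the
    integrals involves [S^2], the second because averaging with [Lam] yields intertwiners through
    the symmetry of [Lam] and [S^2 = 1]. For [S^2 = 1], the trace of [S^2] is [d eps(Lam)], while
    its trace on the image of the idempotent is [eps(Lam)], which is therefore an integer, and
    semisimplicity makes it nonzero. An involution of a [d]-dimensional space has trace between [-d]
    and [d], so only [d] and [-d] remain; [S^2(1) = 1] fixes the sign. *)

Definition lin (V W : lmodType k) (F : V -> W) : Prop :=
  forall c x y, F (c *: x + y) = c *: F x + F y.

Section Lin.
Variables (V W : lmodType k) (F : V -> W).
Hypothesis linF : lin F.

Lemma lin0 : F 0 = 0.
Proof. by have := linF (-1) 0 0; rewrite scaler0 addr0 scaleN1r addNr. Qed.

Lemma linD x y : F (x + y) = F x + F y.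
Proof. by rewrite -[x]scale1r linF !scale1r. Qed.

Lemma linZ c x : F (c *: x) = c *: F x.
Proof. by rewrite -[c *: x]addr0 linF lin0 addr0. Qed.

Lemma lin_sum (I : Type) (r : seq I) (P : pred I) (G : I -> V) :
  F (\sum_(i <- r | P i) G i) = \sum_(i <- r | P i) F (G i).
Proof.
by apply: (big_ind2 (fun x y => F x = y)) => // [|x1 x2 y1 y2 <- <-];
  rewrite ?lin0 ?linD.
Qed.

End Lin.

Lemma row_hbasis a : a = \sum_i a 0 i *: hbasis k i.
Proof. exact: row_sum_delta. Qed.

Lemma lin_basis (W : lmodType k) (F : H -> W) a :
  lin F -> F a = \sum_i a 0 i *: F (hbasis k i).
Proof.
move=> linF; rewrite {1}[a]row_hbasis (lin_sum linF).
by apply: eq_bigr => i _; rewrite (linZ linF).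
Qed.

Lemma lin_id (V : lmodType k) : lin (fun x : V => x).
Proof. by []. Qed.

Lemma lin_comp (U V W : lmodType k) (F : V -> W) (G : U -> V) :
  lin F -> lin G -> lin (fun x => F (G x)).
Proof. by move=> linF linG c x y; rewrite linG linF. Qed.

Lemma lin_scaler (V W : lmodType k) (G : V -> W) (c : k) :
  lin G -> lin (fun x => c *: G x).
Proof. by move=> linG e x y; rewrite linG scalerDr !scalerA mulrC. Qed.

Lemma lin_scalel (V W : lmodType k) (G : V -> k^o) (w : W) :
  lin G -> lin (fun x => (G x : k) *: w).
Proof. by move=> linG e x y; rewrite linG scalerDl scalerA. Qed.

Lemma lin_mulkl (V : lmodType k) (G : V -> k^o) (c : k) :
  lin G -> lin (fun x => (G x : k) * c : k^o).
Proof. move=> linG e x y; rewrite linG mulrDl.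
by rewrite -[e *: (G x * c : k^o)]/(e * (G x * c)) mulrA. Qed.

Lemma lin_mulkr (V : lmodType k) (G : V -> k^o) (c : k) :
  lin G -> lin (fun x => c * (G x : k) : k^o).
Proof. move=> linG e x y; rewrite linG mulrDr.
by rewrite -[e *: (c * G x : k^o)]/(e * (c * G x)) mulrCA. Qed.

Lemma lin_bigsum (V W : lmodType k) (I : Type) (r : seq I) (P : pred I)
    (F : I -> V -> W) :
  (forall i, lin (F i)) -> lin (fun x => \sum_(i <- r | P i) F i x).
Proof.
move=> linF c x y; rewrite scaler_sumr -big_split.
by apply: eq_bigr => i _; rewrite linF.
Qed.

Lemma hpairC p a : hpair p a = hpair a p.
Proof. by apply: eq_bigr => i _; rewrite mulrC. Qed.

Lemma hpair_linr p : lin (hpair p : H -> k^o).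
Proof.
move=> c x y; rewrite /hpair scaler_sumr -big_split /=.
by apply: eq_bigr => i _; rewrite !mxE mulrDr mulrCA.
Qed.

Lemma lin_hpair (V : lmodType k) p (G : V -> H) :
  lin G -> lin (fun x => hpair p (G x) : k^o).
Proof. exact: (lin_comp (@hpair_linr p)). Qed.

Lemma lin_hpair_scale (V W : lmodType k) p (G : V -> H) (w : W) :
  lin G -> lin (fun x => hpair p (G x) *: w).
Proof. by move=> linG; apply: lin_scalel (lin_hpair p linG). Qed.

Lemma lin_hpair_mull (V : lmodType k) p (G : V -> H) (c : k) :
  lin G -> lin (fun x => hpair p (G x) * c : k^o).
Proof. by move=> linG; apply: lin_mulkl (lin_hpair p linG). Qed.

Lemma lin_hpair_mulr (V : lmodType k) p (G : V -> H) (c : k) :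
  lin G -> lin (fun x => c * hpair p (G x) : k^o).
Proof. by move=> linG; apply: lin_mulkr (lin_hpair p linG). Qed.

Lemma hpairZr c p a : hpair p (c *: a) = c * hpair p a.
Proof. exact: (linZ (@hpair_linr p)). Qed.

Lemma hpairZl c p a : hpair (c *: p) a = c * hpair p a.
Proof. by rewrite hpairC hpairZr hpairC. Qed.

Lemma hpair_linl a : lin ((hpair (k := k) (d := d))^~ a : H -> k^o).
Proof. by move=> c x y; rewrite ![hpair _ a]hpairC hpair_linr. Qed.

Lemma hpair_basisl i a : hpair (hbasis k i) a = a 0 i.
Proof.
rewrite /hpair (bigD1 i) //= mxE !eqxx mul1r big1 ?addr0 // => j ji.
by rewrite mxE (negPf ji) andbF mul0r.
Qed.

Lemma hpair_basisr i p : hpair p (hbasis k i) = p 0 i.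
Proof. by rewrite hpairC hpair_basisl. Qed.

Lemma hpair_ext a b : (forall p, hpair p a = hpair p b) -> a = b.
Proof. by move=> ab; apply/rowP => i; rewrite -!hpair_basisl. Qed.

Lemma hpair_extl p q : (forall a, hpair p a = hpair q a) -> p = q.
Proof. by move=> pq; apply: hpair_ext => a; rewrite !(hpairC a). Qed.

End Multilinear.

Section Structure.
Variables (k : fieldType) (d : nat) (D : hopf_data k d).
Local Notation H := 'rV[k]_d.
Implicit Types (a b p q : H) (W : lmodType k).
Local Notation e := (hbasis k).

(* [F a_(1) a_(2)] in Sweedler notation. Since [F] is only evaluated on basis
   vectors, coassociativity and exchange hold without linearity of [F]. *)
Definition sweedler W a (F : H -> H -> W) : W :=
  \sum_i \sum_j hDelta D a i j *: F (e i) (e j).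

Lemma hmul_linl b : lin (fun a => hmul D a b).
Proof.
move=> c x y; apply/rowP=> l; rewrite !mxE mulr_sumr -big_split /=.
apply: eq_bigr => i _; rewrite mulr_sumr -big_split /=.
by apply: eq_bigr => j _; rewrite !mxE !mulrDl !mulrA.
Qed.

Lemma hmul_linr a : lin (hmul D a).
Proof.
move=> c x y; apply/rowP=> l; rewrite !mxE mulr_sumr -big_split /=.
apply: eq_bigr => i _; rewrite mulr_sumr -big_split /=.
apply: eq_bigr => j _; rewrite !mxE !mulrDr !mulrDl; congr (_ + _).
by rewrite !mulrA [_ * c]mulrC.
Qed.

Lemma hmulZl c a b : hmul D (c *: a) b = c *: hmul D a b.
Proof. exact: (linZ (hmul_linl b)). Qed.

Lemma hmulZr c a b : hmul D a (c *: b) = c *: hmul D a b.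
Proof. exact: (linZ (hmul_linr a)). Qed.

Lemma hconv_linl b : lin (fun a => hconv D a b).
Proof.
move=> c x y; apply/rowP=> l; rewrite !mxE mulr_sumr -big_split /=.
apply: eq_bigr => i _; rewrite mulr_sumr -big_split /=.
apply: eq_bigr => j _; rewrite !mxE !mulrDr !mulrDl; congr (_ + _).
by rewrite !mulrA [_ * c]mulrC.
Qed.

Lemma hconv_linr a : lin (hconv D a).
Proof.
move=> c x y; apply/rowP=> l; rewrite !mxE mulr_sumr -big_split /=.
apply: eq_bigr => i _; rewrite mulr_sumr -big_split /=.
apply: eq_bigr => j _; rewrite !mxE !mulrDr; congr (_ + _).
by rewrite !mulrA [_ * c]mulrC !mulrA.
Qed.

Lemma hS_lin : lin (hS D).
Proof. by move=> c x y; rewrite /hS mulmxDl scalemxAl. Qed.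

Lemma hact_lin n (rho : 'I_d -> 'M[k]_n) : lin (hact rho).
Proof.
move=> c x y; rewrite /hact scaler_sumr -big_split.
by apply: eq_bigr => i _; rewrite !mxE scalerDl scalerA.
Qed.

Lemma hDelta_lin : lin (hDelta D).
Proof.
move=> c x y; apply/matrixP=> i j; rewrite !mxE mulr_sumr -big_split /=.
by apply: eq_bigr => l _; rewrite !mxE mulrDl mulrA.
Qed.

Lemma hDelta_basis l i j : hDelta D (e l) i j = hdelta D l i j.
Proof.
rewrite mxE (bigD1 l) //= mxE !eqxx mul1r big1 ?addr0 // => m ml.
by rewrite mxE (negPf ml) andbF mul0r.
Qed.

Lemma hmul_basis i j : hmul D (e i) (e j) = \sum_l hmu D i j l *: e l.
Proof.
rewrite [LHS]row_hbasis; apply: eq_bigr => l _; congr (_ *: _).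
rewrite mxE (bigD1 i) //= [X in _ + X]big1 ?addr0 => [|m mi]; last first.
  by rewrite big1 // => m' _; rewrite mxE (negPf mi) andbF !mul0r.
rewrite (bigD1 j) //= [X in _ + X]big1 ?addr0 => [|m mi]; last first.
  by rewrite !mxE (negPf mi) andbF mulr0 mul0r.
by rewrite !mxE !eqxx !mul1r.
Qed.

Lemma sw_lin W (F : H -> H -> W) : lin (fun a => sweedler a F).
Proof.
move=> c x y; rewrite /sweedler hDelta_lin scaler_sumr -big_split /=.
apply: eq_bigr => i _; rewrite scaler_sumr -big_split /=.
by apply: eq_bigr => j _; rewrite !mxE scalerDl scalerA.
Qed.

Lemma eq_sw W a (F G : H -> H -> W) :
  (forall x y, F x y = G x y) -> sweedler a F = sweedler a G.
Proof. by move=> FG; apply: eq_bigr => i _; apply: eq_bigr => j _; rewrite FG. Qed.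

(* Same as [eq_sw] for [W := k^o], which unification does not infer. *)
Lemma eq_swk a (F G : H -> H -> k^o) :
  (forall x y, F x y = G x y) -> sweedler a F = sweedler a G :> k.
Proof. exact: eq_sw. Qed.

Lemma lin_sw W (V : lmodType k) a (F : V -> H -> H -> W) :
  (forall x y, lin (fun v => F v x y)) -> lin (fun v => sweedler a (F v)).
Proof.
move=> linF; apply: lin_bigsum => i; apply: lin_bigsum => j.
exact: lin_scaler.
Qed.

Lemma sw_map W (V : lmodType k) a (F : H -> H -> W) (G : W -> V) :
  lin G -> G (sweedler a F) = sweedler a (fun x y => G (F x y)).
Proof.
move=> linG; rewrite (lin_sum linG); apply: eq_bigr => i _.
rewrite (lin_sum linG); apply: eq_bigr => j _; exact: linZ.
Qed.

Lemma sw_basis W l (F : H -> H -> W) :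
  sweedler (e l) F = \sum_i \sum_j hdelta D l i j *: F (e i) (e j).
Proof. by apply: eq_bigr => i _; apply: eq_bigr => j _; rewrite hDelta_basis. Qed.

Lemma sw_exchange W a b (F : H -> H -> H -> H -> W) :
  sweedler a (fun x y => sweedler b (F x y)) =
  sweedler b (fun z t => sweedler a (fun x y => F x y z t)).
Proof.
rewrite /sweedler.
under eq_bigr => i _ do under eq_bigr => j _ do rewrite scaler_sumr.
under eq_bigr => i _ do rewrite exchange_big.
rewrite exchange_big; apply: eq_bigr => u _ /=.
under eq_bigr => i _ do under eq_bigr => j _ do rewrite scaler_sumr.
under eq_bigr => i _ do rewrite exchange_big.
rewrite exchange_big; apply: eq_bigr => v _ /=.
rewrite scaler_sumr; apply: eq_bigr => i _; rewrite scaler_sumr.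
by apply: eq_bigr => j _; rewrite !scalerA mulrC.
Qed.

Lemma hpair_hconv p q a :
  hpair (hconv D p q) a = sweedler a (fun x y => hpair p x * hpair q y : k^o).
Proof.
transitivity (\sum_i \sum_j \sum_l a 0 l * hdelta D l i j * (p 0 i * q 0 j)).
  rewrite [RHS](eq_bigr _ (fun i _ => exchange_big _ _ _ _ _ _)) exchange_big.
  apply: eq_bigr => l _ /=; rewrite mxE mulr_suml; apply: eq_bigr => i _.
  by rewrite mulr_suml; apply: eq_bigr => j _; rewrite mulrC !mulrA.
apply: eq_bigr => i _; apply: eq_bigr => j _; rewrite !hpair_basisr.
by rewrite -[RHS]/(_ * _) mxE mulr_suml.
Qed.

Lemma hpair_hit p q a : hpair q (hit D a p) = hpair (hconv D p q) a.
Proof.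
rewrite hpair_hconv /sweedler [RHS]exchange_big; apply: eq_bigr => j _ /=.
rewrite mxE mulr_sumr.
transitivity (\sum_i \sum_l a 0 l * hdelta D l i j * (p 0 i * q 0 j)).
  rewrite exchange_big; apply: eq_bigr => l _ /=; rewrite mulr_sumr.
  by apply: eq_bigr => i _; rewrite mulrC !mulrA.
apply: eq_bigr => i _; rewrite !hpair_basisr.
by rewrite -[RHS]/(_ * _) mxE mulr_suml.
Qed.
End Structure.
Arguments hS_lin {k d D}.
Arguments hDelta_lin {k d D}.

Ltac lin_tac :=
  intros;
  repeat match goal with
  | |- lin (fun x => x) => exact: lin_id
  | |- lin (fun x => sweedler ?D (@?g x) ?G) =>
      apply: (lin_comp (F := fun z => sweedler D z G) (G := g));
      first exact: sw_lin
  | |- lin (fun x => sweedler _ _ _) => apply: lin_sw; intros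
  | |- lin (hmul _ ?b) => exact: hmul_linr
  | |- lin (fun x => hmul _ (@?g x) ?b) =>
      apply: (lin_comp (F := fun z => hmul _ z b) (G := g));
      first exact: hmul_linl
  | |- lin (fun x => hmul _ ?a (@?g x)) =>
      apply: (lin_comp (F := hmul _ a) (G := g));
      first exact: hmul_linr
  | |- lin (hS _) => exact: hS_lin
  | |- lin (fun x => hS _ (@?g x)) =>
      apply: (lin_comp (F := hS _) (G := g));
      first exact: hS_lin
  | |- lin (fun x => hpair _ _ *: _) => apply: lin_hpair_scale
  | |- lin (fun x => hpair _ _ * _) => apply: lin_hpair_mull
  | |- lin (fun x => _ * hpair _ _) => apply: lin_hpair_mulr
  | |- lin (fun x => hpair _ _) => apply: lin_hpair
  | |- lin (fun x => _ *: _) => apply: lin_scaler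
  | H : forall y, lin (fun x => ?F x y) |- lin (fun x => ?F (@?g x) ?b) =>
      apply: (lin_comp (F := fun z => F z b) (G := g)); first exact: H
  | H : forall x, lin (?F x) |- lin (fun x => ?F ?a (@?g x)) =>
      apply: (lin_comp (F := F a) (G := g)); first exact: H
  | H : lin ?F |- lin (fun x => ?F (@?g x)) =>
      apply: (lin_comp (F := F) (G := g)); first exact: H
  end.

(** * Hopf algebras with integrals *)

Section HopfAlgebra.
Variables (k : fieldType) (d : nat) (D : hopf_data k d).
Hypothesis hopfD : is_hopf D.
Local Notation H := 'rV[k]_d.
Implicit Types (a b p q : H) (W : lmodType k).
Local Notation e := (hbasis k).
Local Notation eps := (hpair (hcounit D)).
Local Notation sw := (sweedler D).
Local Notation S := (hS D).
Local Infix "**" := (hmul D) (at level 40, left associativity).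

Lemma hmulA a b c : a ** b ** c = a ** (b ** c).
Proof. by case: hopfD. Qed.

Lemma hmul1l a : hunit D ** a = a.
Proof. by case: hopfD => _ [] /(_ a) []. Qed.

Lemma hmul1r a : a ** hunit D = a.
Proof. by case: hopfD => _ [] /(_ a) []. Qed.

Lemma hconvA p q r : hconv D (hconv D p q) r = hconv D p (hconv D q r).
Proof. by case: hopfD => _ [_ []]. Qed.

Lemma hconv1l p : hconv D (hcounit D) p = p.
Proof. by case: hopfD => _ [_ [_ []]] /(_ p) []. Qed.

Lemma hconv1r p : hconv D p (hcounit D) = p.
Proof. by case: hopfD => _ [_ [_ []]] /(_ p) []. Qed.

Lemma epsM a b : eps (a ** b) = eps a * eps b.
Proof. by case: hopfD => _ [_ [_ [_ [_ [[]]]]]]. Qed.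

Lemma eps1 : eps (hunit D) = 1.
Proof. by case: hopfD => _ [_ [_ [_ [_ [[]]]]]]. Qed.

(** Associativity of [hconv], evaluated at three dual basis vectors, is the identity [assoc] between
    structure constants; both sides expand into such constants. *)
Lemma sw_assoc W a (G : H -> H -> H -> W) :
  sw a (fun x y => sw x (fun x1 x2 => G x1 x2 y)) =
  sw a (fun x y => sw y (fun y1 y2 => G x y1 y2)).
Proof.
suff assoc u v w : \sum_i hDelta D a i w * hdelta D i u v =
                   \sum_j hDelta D a u j * hdelta D j v w.
  rewrite /sweedler.
  transitivity (\sum_u \sum_v \sum_w
    (\sum_i hDelta D a i w * hdelta D i u v) *: G (e u) (e v) (e w)).
    under eq_bigr => i _ do under eq_bigr => j _ do rewrite scaler_sumr.
    under eq_bigr => i _ do rewrite exchange_big.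
    rewrite exchange_big; apply: eq_bigr => u _ /=.
    under eq_bigr => i _ do under eq_bigr => j _ do rewrite scaler_sumr.
    under eq_bigr => i _ do rewrite exchange_big.
    rewrite exchange_big; apply: eq_bigr => v _ /=.
    rewrite exchange_big; apply: eq_bigr => w _ /=; rewrite scaler_suml.
    by apply: eq_bigr => i _; rewrite hDelta_basis scalerA.
  apply: eq_bigr => u _.
  under [RHS]eq_bigr => j _ do rewrite scaler_sumr.
  rewrite [RHS]exchange_big; apply: eq_bigr => v _ /=.
  under [RHS]eq_bigr => i _ do rewrite scaler_sumr.
  rewrite [RHS]exchange_big; apply: eq_bigr => w _ /=.
  rewrite assoc scaler_suml.
  by apply: eq_bigr => i _; rewrite hDelta_basis scalerA.
have delta_l (g : 'I_d -> k) x : \sum_y g y * hpair (e x) (e y) = g x.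
  rewrite (bigD1 x) //= hpair_basisl mxE !eqxx mulr1 big1 ?addr0 // => y yx.
  by rewrite hpair_basisl mxE eq_sym (negPf yx) andbF mulr0.
have hconv_basis x y z : hpair (hconv D (e x) (e y)) (e z) = hdelta D z x y.
  rewrite hpair_hconv sw_basis -[RHS](delta_l (hdelta D z ^~ y)).
  apply: eq_bigr => i _; rewrite -(delta_l (hdelta D z i)) mulr_suml.
  by apply: eq_bigr => j _; rewrite -[LHS]/(_ * _) [_ * hpair _ (e j)]mulrC mulrA.
have := congr1 (fun z => hpair z a) (hconvA (e u) (e v) (e w)).
rewrite hpair_hconv [RHS]hpair_hconv /sweedler => coassoc.
transitivity (\sum_i \sum_j hDelta D a i j *:
   (hpair (hconv D (e u) (e v)) (e i) * hpair (e w) (e j) : k^o)).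
  apply: eq_bigr => i _; rewrite -(delta_l (hDelta D a i)) mulr_suml.
  apply: eq_bigr => j _; rewrite -[RHS]/(_ * _) hconv_basis.
  by rewrite mulrAC mulrA.
rewrite coassoc -(delta_l (fun i => \sum_j hDelta D a i j * hdelta D j v w)).
apply: eq_bigr => i _; rewrite mulr_suml; apply: eq_bigr => j _.
by rewrite -[LHS]/(_ * _) hconv_basis mulrA mulrAC.
Qed.

Lemma sw_counitl W a (F : H -> W) :
  lin F -> sw a (fun x y => eps x *: F y) = F a.
Proof.
move=> linF; rewrite -[in RHS](_ : sw a (fun x y => eps x *: y) = a).
  by rewrite (sw_map _ _ _ linF); apply: eq_sw => x y; rewrite (linZ linF).
apply: hpair_ext => p; rewrite (sw_map _ _ _ (@hpair_linr _ _ p)) -[in RHS](hconv1l p).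
by rewrite hpair_hconv; apply: eq_swk => x y; rewrite hpairZr.
Qed.

Lemma sw_counitr W a (F : H -> W) :
  lin F -> sw a (fun x y => eps y *: F x) = F a.
Proof.
move=> linF; rewrite -[in RHS](_ : sw a (fun x y => eps y *: x) = a).
  by rewrite (sw_map _ _ _ linF); apply: eq_sw => x y; rewrite (linZ linF).
apply: hpair_ext => p; rewrite (sw_map _ _ _ (@hpair_linr _ _ p)) -[in RHS](hconv1r p).
rewrite hpair_hconv; apply: eq_swk => x y; rewrite hpairZr.
by rewrite mulrC.
Qed.

Lemma sw_mul W a b (F : H -> H -> W) :
  (forall y, lin (fun x => F x y)) -> (forall x, lin (F x)) ->
  sw (a ** b) F = sw a (fun x y => sw b (fun z t => F (x ** z) (y ** t))).
Proof.
move=> linl linr.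
have DeltaM : hDelta D (a ** b) = tmul D (hDelta D a) (hDelta D b).
  by case: hopfD => _ [_ [_ [_ [[]]]]].
have FE i j i' j' : F (e i ** e i') (e j ** e j') =
    \sum_l \sum_m (hmu D i i' l * hmu D j j' m) *: F (e l) (e m).
  rewrite !hmul_basis (lin_sum (linl _)); apply: eq_bigr => l _.
  rewrite (linZ (linl _)) (lin_sum (linr _)) scaler_sumr.
  by apply: eq_bigr => m _; rewrite (linZ (linr _)) scalerA.
rewrite /sweedler DeltaM.
transitivity (\sum_l \sum_m \sum_i \sum_j \sum_i' \sum_j'
  (hDelta D a i j * hDelta D b i' j' * hmu D i i' l * hmu D j j' m)
     *: F (e l) (e m)).
  apply: eq_bigr => l _; apply: eq_bigr => m _.
  rewrite mxE scaler_suml; apply: eq_bigr => i _.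
  rewrite scaler_suml; apply: eq_bigr => j _.
  rewrite scaler_suml; apply: eq_bigr => i' _.
  by rewrite scaler_suml; apply: eq_bigr.
under eq_bigr => l _ do rewrite exchange_big.
rewrite exchange_big; apply: eq_bigr => i _ /=.
under eq_bigr => l _ do rewrite exchange_big.
rewrite exchange_big; apply: eq_bigr => j _ /=.
under eq_bigr => l _ do rewrite exchange_big.
rewrite exchange_big scaler_sumr; apply: eq_bigr => i' _ /=.
under eq_bigr => l _ do rewrite exchange_big.
rewrite exchange_big scaler_sumr; apply: eq_bigr => j' _ /=.
rewrite FE !scaler_sumr; apply: eq_bigr => l _.
by rewrite !scaler_sumr; apply: eq_bigr => m _; rewrite !scalerA !mulrA.
Qed.

Lemma sw_one W (F : H -> H -> W) :
  (forall y, lin (fun x => F x y)) -> (forall x, lin (F x)) ->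
  sw (hunit D) F = F (hunit D) (hunit D).
Proof.
move=> linl linr.
have Delta1 : hDelta D (hunit D) = \matrix_(i, j) (hunit D 0 i * hunit D 0 j).
  by case: hopfD => _ [_ [_ [_ [[]]]]].
rewrite /sweedler Delta1 [RHS](lin_basis _ (linl _)).
apply: eq_bigr => i _; rewrite (lin_basis _ (linr _)) scaler_sumr.
by apply: eq_bigr => j _; rewrite mxE scalerA.
Qed.

Lemma sw_antil W a (F : H -> W) :
  lin F -> sw a (fun x y => F (S x ** y)) = eps a *: F (hunit D).
Proof.
move=> linF; rewrite -(linZ linF) -(sw_map D a (fun x y => S x ** y) linF).
by congr F; case: hopfD => _ [_ [_ [_ [_ [_ /(_ a)]]]]] [].
Qed.

Lemma sw_antir W a (F : H -> W) :
  lin F -> sw a (fun x y => F (x ** S y)) = eps a *: F (hunit D).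
Proof.
move=> linF; rewrite -(linZ linF) -(sw_map D a (fun x y => x ** S y) linF).
by congr F; case: hopfD => _ [_ [_ [_ [_ [_ /(_ a)]]]]] [].
Qed.

Lemma S1 : S (hunit D) = hunit D.
Proof.
have /= := sw_antil (hunit D) (@lin_id k _); rewrite eps1 scale1r => {2}<-.
by rewrite sw_one ?hmul1r //; lin_tac.
Qed.

(** * The Frobenius structure given by a pair of integrals *)

Section Integrals.
Variables Lam lam : H.
Hypotheses (Lam_int : is_integral_H D Lam) (lam_int : is_integral_Hdual D lam).
Hypothesis lamLam : hpair lam Lam = 1.

Lemma sw_lamr a : sw a (fun x y => hpair lam y *: x) = hpair lam a *: hunit D.
Proof.
apply: hpair_ext => p; rewrite (sw_map _ _ _ (@hpair_linr _ _ p)).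
rewrite hpairZr mulrC.
rewrite -hpairZl -(proj1 (lam_int p)) hpair_hconv.
by apply: eq_swk => x y; rewrite hpairZr mulrC.
Qed.

Lemma sw_laml a : sw a (fun x y => hpair lam x *: y) = hpair lam a *: hunit D.
Proof.
apply: hpair_ext => p; rewrite (sw_map _ _ _ (@hpair_linr _ _ p)).
rewrite hpairZr mulrC.
rewrite -hpairZl -(proj2 (lam_int p)) hpair_hconv.
by apply: eq_swk => x y; rewrite hpairZr.
Qed.

(** Inserting [S(b_1) b_2] before the first leg gives [S(b_1) (b_2 Lam)_1 (x) (b_2 Lam)_2], and
    [b_2 Lam = eps(b_2) Lam]. *)
Lemma sw_Lam W b (F : H -> H -> W) :
  (forall y, lin (fun x => F x y)) -> (forall x, lin (F x)) ->
  sw Lam (fun x y => F x (b ** y)) = sw Lam (fun x y => F (S b ** x) y).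
Proof.
move=> linl linr.
transitivity (sw b (fun u v => sw u (fun u1 u2 =>
    sw Lam (fun x y => F (S u1 ** u2 ** x) (v ** y))))).
  pose G z v := sw Lam (fun x y => F (z ** x) (v ** y)).
  have linG1 v : lin (G^~ v) by rewrite /G; lin_tac.
  have linG2 v : lin (G v) by rewrite /G; lin_tac.
  transitivity (G (hunit D) b).
    by apply: eq_sw => x y; rewrite hmul1l.
  rewrite -(sw_counitl _ (linG2 (hunit D))); apply: eq_sw => u v.
  exact: esym (sw_antil u (linG1 v)).
pose K u := sw Lam (fun x y => F (S u ** x) y).
have linK : lin K by rewrite /K; lin_tac.
rewrite -[RHS]/(K b) sw_assoc -(sw_counitr b linK); apply: eq_sw => u v.
rewrite -(linZ (@sw_lin _ _ D _ _)) -(proj1 (Lam_int v)) sw_mul //; last by lin_tac.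
by apply: eq_sw => x y; apply: eq_sw => z t; rewrite hmulA.
Qed.

(** Dual to [sw_Lam]: once [S(a_1) a_2] is inserted before [b_1], the sum contains
    [lam((a_2 b)_2) (a_2 b)_1], which is [lam(a_2 b) 1] because [lam] is an integral. *)
Lemma sw_lam_antil a b :
  sw b (fun x y => hpair lam (a ** y) *: x) =
  sw a (fun x y => hpair lam (y ** b) *: S x).
Proof.
transitivity (sw a (fun u v => sw u (fun u1 u2 =>
    sw b (fun x y => hpair lam (v ** y) *: (S u1 ** u2 ** x))))).
  pose G z v := sw b (fun x y => hpair lam (v ** y) *: (z ** x)).
  have linG1 v : lin (G^~ v) by rewrite /G; lin_tac.
  have linG2 v : lin (G v) by rewrite /G; lin_tac.
  transitivity (G (hunit D) a).
    by apply: eq_sw => x y; rewrite hmul1l.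
  rewrite -(sw_counitl _ (linG2 (hunit D))); apply: eq_sw => u v.
  exact: esym (sw_antil u (linG1 v)).
rewrite sw_assoc; apply: eq_sw => u v.
rewrite -[in RHS](hmul1r (S u)) -hmulZr -sw_lamr.
rewrite (sw_map _ _ _ (@hmul_linr _ _ D (S u))) sw_mul; try by lin_tac.
apply: eq_sw => x y; apply: eq_sw => z t.
by rewrite hmulZr hmulA.
Qed.

Lemma sw_lam_antir a b :
  sw a (fun x y => hpair lam (x ** b) *: y) =
  sw b (fun x y => hpair lam (a ** x) *: S y).
Proof.
transitivity (sw b (fun u v => sw v (fun v1 v2 =>
    sw a (fun x y => hpair lam (x ** u) *: (y ** (v1 ** S v2)))))).
  pose G z v := sw a (fun x y => hpair lam (x ** v) *: (y ** z)).
  have linG1 v : lin (G^~ v) by rewrite /G; lin_tac.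
  have linG2 v : lin (G v) by rewrite /G; lin_tac.
  transitivity (G (hunit D) b).
    by apply: eq_sw => x y; rewrite hmul1r.
  rewrite -(sw_counitr _ (linG2 (hunit D))); apply: eq_sw => u v.
  exact: esym (sw_antir v (linG1 u)).
rewrite -sw_assoc; apply: eq_sw => u v.
rewrite -[in RHS](hmul1l (S v)) -hmulZl -sw_laml.
rewrite (sw_map _ _ _ (@hmul_linl _ _ D (S v))) sw_mul; try by lin_tac.
rewrite sw_exchange.
apply: eq_sw => x y; apply: eq_sw => z t.
by rewrite /= hmulZl hmulA.
Qed.

Lemma lam_Lam a : hpair lam (a ** Lam) = eps a.
Proof.
by rewrite (proj1 (Lam_int a)) hpairZr lamLam mulr1.
Qed.

Lemma lam_Laml a : hpair lam (Lam ** a) = eps a.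
Proof.
by rewrite (proj2 (Lam_int a)) hpairZr lamLam mulr1.
Qed.

(** Here and in the next three lemmas one argument of the two exchange identities is [Lam]. The
    antipode becomes expressible through the form [lam(a b)], and [S(Lam_1)], [Lam_2] become dual
    bases for it. *)
Lemma S_Lam1 a : sw Lam (fun x y => hpair lam (a ** y) *: x) = S a.
Proof.
rewrite sw_lam_antil -[RHS](sw_counitr a hS_lin).
by apply: eq_sw => x y; rewrite lam_Lam.
Qed.

Lemma S_Lam2 a : sw Lam (fun x y => hpair lam (x ** a) *: y) = S a.
Proof.
rewrite sw_lam_antir -[RHS](sw_counitl a hS_lin).
by apply: eq_sw => x y; rewrite lam_Laml.
Qed.

Lemma id_Lam1 a : sw Lam (fun x y => hpair lam (y ** a) *: S x) = a.
Proof.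
rewrite -sw_lam_antil -[RHS](sw_counitr a (@lin_id k _)).
by apply: eq_sw => x y; rewrite lam_Laml.
Qed.

Lemma id_Lam2 a : sw Lam (fun x y => hpair lam (a ** x) *: S y) = a.
Proof.
rewrite -sw_lam_antir -[RHS](sw_counitl a (@lin_id k _)).
by apply: eq_sw => x y; rewrite lam_Lam.
Qed.

(** By [S_Lam1], [S(a b) = lam(a b Lam_2) Lam_1], and [sw_Lam] carries [b] to the other leg as
    [S(b)]. *)
Lemma S_anti a b : S (a ** b) = S b ** S a.
Proof.
rewrite -(S_Lam1 (a ** b)) -(S_Lam1 a).
rewrite (sw_map _ _ _ (@hmul_linr _ _ D (S b))).
under eq_sw => x y do rewrite hmulA.
rewrite (sw_Lam b (F := fun x y => hpair lam (a ** y) *: x)); try by lin_tac.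
by apply: eq_sw => x y; rewrite hmulZr.
Qed.

(** Comultiply [S(a) = lam(a Lam_2) Lam_1] and reassociate: [lam(a Lam_3) Lam_2] becomes
    [lam(a_2 Lam_2) S(a_1)], and the sum left over is [S(a_2)]. *)
Lemma sw_S W a (F : H -> H -> W) :
  (forall y, lin (fun x => F x y)) -> (forall x, lin (F x)) ->
  sw (S a) F = sw a (fun x y => F (S y) (S x)).
Proof.
move=> linl linr; rewrite -{1}(S_Lam1 a) (sw_map _ _ _ (@sw_lin _ _ D _ F)).
transitivity (sw Lam (fun x y => sw x (fun z t => hpair lam (a ** y) *: F z t))).
  apply: eq_sw => x y; rewrite (linZ (@sw_lin _ _ D _ F)).
  by rewrite (sw_map _ _ _ (lin_scaler _ (@lin_id k _))).
rewrite sw_assoc.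
transitivity (sw Lam (fun x y => F x (sw y (fun z t => hpair lam (a ** t) *: z)))).
  apply: eq_sw => x y; rewrite (sw_map _ _ _ (linr x)).
  by apply: eq_sw => z t; rewrite (linZ (linr x)).
transitivity (sw Lam (fun x y => sw a (fun z t => F (hpair lam (t ** y) *: x) (S z)))).
  apply: eq_sw => x y; rewrite sw_lam_antil (sw_map _ _ _ (linr x)).
  by apply: eq_sw => z t; rewrite (linZ (linr x)) (linZ (linl _)).
rewrite sw_exchange; apply: eq_sw => x y.
by rewrite -(sw_map _ _ _ (linl (S x))) S_Lam1.
Qed.

End Integrals.
End HopfAlgebra.

(** * Traces and idempotent matrices *)

Section LinearMatrices.
Variables (k : fieldType) (d : nat).
Local Notation H := 'rV[k]_d.
Local Notation e := (hbasis k).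

Definition linmx (F : H -> H) : 'M[k]_d := \matrix_i F (e i).

Lemma mul_linmx (F : H -> H) a : lin F -> a *m linmx F = F a.
Proof.
move=> linF; rewrite mulmx_sum_row (lin_basis _ linF).
by apply: eq_bigr => i _; rewrite rowK.
Qed.

Lemma linmx_mul (F : H -> H) M : (forall a, F a = a *m M) -> linmx F = M.
Proof. by move=> FM; apply/row_matrixP => i; rewrite rowK FM -rowE. Qed.

Lemma eq_linmx (F G : H -> H) : F =1 G -> linmx F = linmx G.
Proof. by move=> FG; apply/row_matrixP => i; rewrite !rowK FG. Qed.

Lemma linmx_comp (F G : H -> H) :
  lin F -> linmx (fun a => F (G a)) = linmx G *m linmx F.
Proof.
by move=> linF; apply/row_matrixP=> i; rewrite row_mul !rowK mul_linmx.
Qed.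

(** Finite dimension: a one-sided inverse of a square matrix is two-sided. *)
Lemma lin_cancel (F G : H -> H) : lin F -> lin G -> cancel F G -> cancel G F.
Proof.
move=> linF linG FK a; rewrite -(mul_linmx _ linF) -(mul_linmx _ linG) -mulmxA.
suff /mulmx1C->: linmx F *m linmx G = 1%:M by rewrite mulmx1.
by rewrite -linmx_comp //; apply: linmx_mul => b; rewrite mulmx1 FK.
Qed.

Lemma tr_linmx (F : H -> H) : \tr (linmx F) = \sum_l F (e l) 0 l.
Proof. by apply: eq_bigr => l _; rewrite mxE. Qed.

Lemma tr_rank1 (g : H -> k^o) v : lin g -> \tr (linmx (fun h => (g h : k) *: v)) = g v.
Proof.
move=> ling; rewrite tr_linmx (lin_basis v ling); apply: eq_bigr => l _.
by rewrite mxE mulrC.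
Qed.

Lemma hpair_row (g : H -> k^o) (p a : H) :
  lin g -> (forall i, p 0 i = g (e i)) -> hpair p a = g a.
Proof.
move=> ling pg; rewrite (lin_basis a ling); apply: eq_bigr => l _.
by rewrite pg mulrC.
Qed.

End LinearMatrices.

Lemma natr_inj (k : fieldType) (char0 : [pchar k] =i pred0) m n :
  m%:R = n%:R :> k -> m = n.
Proof.
move: m n; suff le_inj m n : (m <= n)%N -> m%:R = n%:R :> k -> m = n.
  by move=> m n; case: (leqP m n) => [|/ltnW] mn e; [|symmetry]; apply: le_inj.
move=> mn /esym/eqP; rewrite -subr_eq0 -natrB // (pcharf0P _).1 // subn_eq0.
by move=> nm; apply/eqP; rewrite eqn_leq mn.
Qed.

Section Idempotents.
Variable k : fieldType.

(** In the rank factorization [P = C R] the equation [C (R C) R = C R] cancels on both sides, since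
    [C] has full column rank and [R] full row rank. *)
Lemma idempotent_factor n (P : 'M[k]_n) :
  P *m P = P -> row_base P *m col_base P = 1%:M.
Proof.
move=> PP; apply: (row_free_inj (row_base_free P)).
apply: (row_full_inj (col_base_full P)).
by rewrite mul1mx mulmx_base -(mulmxA (row_base P)) mulmx_base mulmxA mulmx_base.
Qed.

Lemma tr_idempotent n (P : 'M[k]_n) : P *m P = P -> \tr P = (\rank P)%:R.
Proof.
by move/idempotent_factor=> eP; rewrite -{1}(mulmx_base P) mxtrace_mulC eP mxtrace1.
Qed.

Lemma involution_tr (char0 : [pchar k] =i pred0) d (M E : 'M[k]_d) :
  M *m M = 1%:M -> E *m E = E -> E *m M = M *m E ->
  \tr M = d%:R * \tr (E *m M) -> \tr M != 0 -> M = 1%:M \/ M = - 1%:M.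
Proof.
move=> MM EE EM trM trM0.
have two_neq0 : 2%:R != 0 :> k by rewrite (pcharf0P _).1.
(* The projection onto the eigenspace of [M] for 1. It turns both traces into integer combinations
   of ranks. *)
pose P := 2%:R^-1 *: (1%:M + M).
have ME : M = 2%:R *: P - 1%:M.
  by rewrite /P scalerA divff // scale1r addrC addKr.
have PP : P *m P = P.
  rewrite /P -scalemxAl -scalemxAr scalerA mulmxDl !mulmxDr !mul1mx mulmx1 MM.
  rewrite [M + 1%:M]addrC -mulr2n -scaler_nat scalerA; congr (_ *: _).
  by rewrite -mulrA mulVf ?mulr1.
have EP : E *m P = P *m E.
  by rewrite /P -scalemxAl -scalemxAr mulmxDl mulmxDr EM mul1mx mulmx1.
have QQ : E *m P *m (E *m P) = E *m P.
  by rewrite mulmxA -(mulmxA E P E) -EP !mulmxA EE -!mulmxA PP.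
have trMr : \tr M = 2%:R * (\rank P)%:R - d%:R.
  by rewrite ME raddfB /= mxtraceZ tr_idempotent // mxtrace1.
have trEM : \tr (E *m M) = 2%:R * (\rank (E *m P))%:R - (\rank E)%:R.
  rewrite ME mulmxDr mulmxN mulmx1 -scalemxAr raddfB /= mxtraceZ.
  by rewrite !tr_idempotent.
have rP : (\rank P <= d)%N by exact: rank_leq_row.
set r := \rank P in trMr rP; set q := \rank _ in trEM; set s := \rank E in trEM.
have eqN : (2 * r + d * s = 2 * d * q + d)%N.
  apply: (natr_inj char0); rewrite !natrD !natrM.
  have : 2%:R * r%:R - d%:R = d%:R * (2%:R * q%:R - s%:R) :> k.
    by rewrite -trMr trM trEM.
  move=> trE; apply/eqP; rewrite -subr_eq0.
  rewrite (_ : _ - _ = 2%:R * r%:R - d%:R - d%:R * (2%:R * q%:R - s%:R)).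
    by rewrite trE subrr.
  by ring.
have neqN : (2 * r != d)%N.
  by apply: contra_neq trM0 => e; rewrite trMr -e natrM subrr.
(* [eqN] says [2r - d = d (2q - s)] with [r <= d]. A positive [2q - s] forces [r = d], a negative
   one [r = 0], and zero contradicts [neqN]. *)
have [r0|rd] : r = 0%N \/ r = d.
  have [sq|qs] := ltnP s (2 * q).
    have := leq_mul2l d s.+1 (2 * q); rewrite sq orbT mulnS; lia.
  have [sq|qs'] := leqP s (2 * q); last first.
    have := leq_mul2l d (2 * q).+1 s; rewrite qs' orbT mulnS; lia.
  have sE : s = (2 * q)%N by lia.
  by move: eqN neqN; rewrite sE mulnCA mulnA; lia.
  right; have P0 : P = 0 by apply/eqP; rewrite -mxrank_eq0 -/r r0.
  by rewrite ME P0 scaler0 add0r.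
left; have Pu : P \in unitmx by rewrite -row_free_unit /row_free -/r rd.
have P1 : P = 1%:M by rewrite -[LHS](mulKmx Pu) PP mulVmx.
by rewrite ME P1 scaler_nat mulr2n addrK.
Qed.

End Idempotents.

(** * The square of the antipode *)

Section SquareAntipode.
Variables (k : fieldType) (d : nat) (D : hopf_data k d).
Hypothesis hopfD : is_hopf D.
Local Notation H := 'rV[k]_d.
Implicit Types (a b p q : H) (W : lmodType k).
Local Notation e := (hbasis k).
Local Notation eps := (hpair (hcounit D)).
Local Notation sw := (sweedler D).
Local Notation S := (hS D).
Local Infix "**" := (hmul D) (at level 40, left associativity).

Lemma hit_sw a p : hit D a p = sw a (fun x y => hpair p x *: y).
Proof.
apply: hpair_ext => q; rewrite hpair_hit hpair_hconv (sw_map _ _ _ (@hpair_linr _ _ q)).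
by apply: eq_swk => x y; rewrite hpairZr.
Qed.

Lemma hit_lin p : lin (fun a => hit D a p).
Proof. by move=> c x y; rewrite !hit_sw sw_lin. Qed.

(** Summing over the output coordinate first contracts the structure constants with [G (e i) (e j)],
    which leaves a coefficient of its comultiplication. *)
Lemma tr_linmx_sw (G : H -> H -> H) :
  \tr (linmx (fun b => sw b G)) = \sum_i \sum_j hDelta D (G (e i) (e j)) i j.
Proof.
rewrite tr_linmx; under eq_bigr => l _ do rewrite sw_basis summxE.
rewrite exchange_big; apply: eq_bigr => i _ /=.
under eq_bigr => l _ do rewrite summxE.
rewrite exchange_big; apply: eq_bigr => j _ /=; rewrite mxE.
by apply: eq_bigr => l _; rewrite mxE mulrC.
Qed.

Lemma hDeltaE a i j : hDelta D a i j = sw a (fun x y => x 0 i * y 0 j : k^o).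
Proof.
have eE m l : e m 0 l = (l == m)%:R :> k by rewrite mxE.
rewrite /sweedler (bigD1 i) //= (bigD1 j) //= !eE !eqxx mulr1.
rewrite [X in _ = _ + X]big1 => [|i' ii']; last first.
  by apply: big1 => j' _; rewrite eE eq_sym (negPf ii') mul0r scaler0.
rewrite [X in _ = _ + X + _]big1 => [|j' jj']; last first.
  by rewrite !eE [j == _]eq_sym (negPf jj') mulr0 scaler0.
by rewrite !addr0 -[RHS]/(_ * _) mulr1.
Qed.

Lemma sw_sum W a (I : finType) (F : I -> H -> H -> W) :
  sw a (fun x y => \sum_i F i x y) = \sum_i sw a (F i).
Proof.
rewrite /sweedler; under eq_bigr => i _ do under eq_bigr => j _ do rewrite scaler_sumr.
under eq_bigr => i _ do rewrite exchange_big.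
by rewrite exchange_big.
Qed.

Lemma sw_sumk a (I : finType) (F : I -> H -> H -> k^o) :
  \sum_i (sw a (F i) : k) = sw a (fun x y => \sum_i F i x y : k^o).
Proof. by rewrite (sw_sum (W := k^o)). Qed.

Lemma sw_mulr (c : k) a (F : H -> H -> k^o) :
  c * sw a F = sw a (fun x y => c * F x y : k^o).
Proof.
rewrite /sweedler mulr_sumr; apply: eq_bigr => i _; rewrite mulr_sumr.
by apply: eq_bigr => j _; rewrite -[RHS]/(_ * _) mulrCA.
Qed.

Definition hreg : H := \row_i \tr (linmx (hmul D (e i))).

Lemma hpair_hreg a : hpair hreg a = \tr (linmx (hmul D a)).
Proof.
apply: (hpair_row (g := fun h => \tr (linmx (hmul D h)))) => [c x y|i];
  last by rewrite mxE.
rewrite !tr_linmx scaler_sumr -big_split; apply: eq_bigr => l _ /=.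
by rewrite hmul_linl !mxE.
Qed.

(* The map [a (x) b |-> a_1 (x) a_2 b] makes the tensor product of the regular
   module with any module free; below its inverse is applied under the trace. *)
Lemma hconv_hreg p :
  (forall a b, hpair p (a ** b) = hpair p (b ** a)) ->
  hconv D hreg p = hpair p (hunit D) *: hreg.
Proof.
move=> pC; apply: hpair_extl => h; rewrite hpairZl hpair_hconv.
pose A w c := sw w (fun z t => hpair p (t ** c) *: z).
have linA c : lin (A^~ c) by exact: sw_lin.
(* The map [b |-> p(h_2) h_1 b] is rewritten as [b |-> p((h b_1)_2 S(b_2)) (h b_1)_1], where [h]
   occurs only in [h b_1]. *)
transitivity (\tr (linmx (fun b => sw b (fun u v => A (h ** u) (S v))))).
  transitivity (\tr (linmx (fun b => sw h (fun x y => hpair p y *: (x ** b))))).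
    rewrite tr_linmx; under [RHS]eq_bigr => l _ do rewrite summxE.
    rewrite exchange_big; apply: eq_bigr => i _ /=.
    under [RHS]eq_bigr => l _ do rewrite summxE.
    rewrite exchange_big; apply: eq_bigr => j _ /=.
    rewrite hpair_hreg tr_linmx -[LHS]/(_ * _) mulr_suml mulr_sumr.
    by apply: eq_bigr => l _; rewrite !mxE [_ * hpair _ _]mulrC.
  congr (\tr _); apply: eq_linmx => b.
  transitivity (sw b (fun u v => sw h (fun x y => sw v (fun v1 v2 =>
      hpair p (y ** (v1 ** S v2)) *: (x ** u))))); last first.
    transitivity (sw b (fun u v => sw u (fun u1 u2 => sw h (fun x y =>
        hpair p (y ** (u2 ** S v)) *: (x ** u1))))).
      by rewrite sw_assoc //; apply: eq_sw => u v; rewrite sw_exchange.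
    apply: eq_sw => u v; rewrite /A sw_mul //; try by lin_tac.
    rewrite sw_exchange; apply: eq_sw => x y; apply: eq_sw => z t.
    by rewrite hmulA.
  transitivity (sw b (fun u v => eps v *: sw h (fun x y => hpair p y *: (x ** u)))).
    rewrite (sw_counitr hopfD b
      (F := fun u => sw h (fun x y => hpair p y *: (x ** u)))) //.
    by lin_tac.
  apply: eq_sw => u v; rewrite [RHS]sw_exchange.
  rewrite (sw_antir hopfD v
    (F := fun w => sw h (fun x y => hpair p (y ** w) *: (x ** u)))); last by lin_tac.
  by congr (_ *: _); apply: eq_sw => x y; rewrite hmul1r.
rewrite tr_linmx_sw hpair_hreg tr_linmx mulr_sumr; apply: eq_bigr => i _.
(* The sum over [j] reassembles the second leg: with [w = h e_i], what remains is the [i]-th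
   coordinate of [w_1] times [p(w_3 S(w_2))]. *)
transitivity (sw (h ** e i) (fun z t =>
    sw z (fun s r => s 0 i * hpair p (t ** S r) : k^o))).
  have inner (z t : H) : \sum_j hDelta D (hpair p (t ** S (e j)) *: z) i j =
      sw z (fun s r => s 0 i * hpair p (t ** S r) : k^o).
    under eq_bigr => j _ do rewrite (linZ hDelta_lin) mxE hDeltaE sw_mulr.
    rewrite sw_sumk.
    apply: eq_swk => s r; have linp : lin (fun r => hpair p (t ** S r) : k^o) by lin_tac.
    rewrite (lin_basis r linp) mulr_sumr; apply: eq_bigr => j _.
    by rewrite mulrCA; congr (_ * _); exact: mulrC.
  transitivity (\sum_j sw (h ** e i) (fun z t =>
      hDelta D (hpair p (t ** S (e j)) *: z) i j : k^o)).
    apply: eq_bigr => j _; rewrite /A (sw_map _ _ _ hDelta_lin) summxE.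
    apply: eq_bigr => u _; rewrite summxE; apply: eq_bigr => v _.
    by rewrite mxE.
  by rewrite sw_sumk; apply: eq_swk => z t; exact: inner.
rewrite (sw_assoc hopfD (h ** e i) (fun s r t => s 0 i * hpair p (t ** S r) : k^o)).
transitivity (sw (h ** e i) (fun s w => eps w *: (s 0 i * hpair p (hunit D) : k^o))).
  apply: eq_swk => s w.
  (* The legs stand in the wrong order for the antipode axiom; the trace property of [p] swaps
     them. *)
  transitivity (sw w (fun r t => s 0 i * hpair p (S r ** t) : k^o)).
    by apply: eq_sw => r t; rewrite pC.
  by rewrite (sw_antil hopfD w (F := fun w => s 0 i * hpair p w : k^o)) //; lin_tac.
rewrite (sw_counitr hopfD _ (F := fun s => s 0 i * hpair p (hunit D) : k^o)) 1?mulrC //.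
by apply: lin_mulkl => c x y; rewrite !mxE.
Qed.

Section Integrals.
Variables Lam lam : H.
Hypotheses (Lam_int : is_integral_H D Lam) (lam_int : is_integral_Hdual D lam).
Hypothesis lamLam : hpair lam Lam = 1.

Lemma lin_hpair_row (F : H -> H -> H) p :
  (forall y, lin (fun x => F x y)) -> lin (fun x => \row_i hpair p (F x (e i))).
Proof.
by move=> linl c x y; apply/rowP=> i; rewrite !mxE linl hpair_linr.
Qed.

(* [b |-> lam (_ * b)] and [phi |-> phi(Lam_2) S(Lam_1)] are inverse to each
   other, and the second map sends [lam (a * _)] to [S (S a)]. *)
Lemma lam_antipode2r a b : hpair lam (a ** b) = hpair lam (b ** S (S a)).
Proof.
pose F b := \row_i hpair lam (e i ** b).
pose G p := sw Lam (fun x y => hpair p y *: S x).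
have linF : lin F.
  by apply: (lin_hpair_row lam (F := fun x y => y ** x)) => y; exact: hmul_linr.
have linG : lin G.
  by rewrite /G; apply: lin_sw => x y; exact: lin_scalel (hpair_linl y).
have FE c x : hpair (F c) x = hpair lam (x ** c).
  by apply: (hpair_row (g := fun x => hpair lam (x ** c)));
    [lin_tac | move=> i; rewrite mxE].
have FK : cancel F G.
  move=> c; rewrite -[RHS](id_Lam1 hopfD Lam_int lam_int lamLam).
  by apply: eq_sw => x y; rewrite FE.
pose p := \row_i hpair lam (a ** e i).
have pE x : hpair p x = hpair lam (a ** x).
  by apply: (hpair_row (g := fun x => hpair lam (a ** x)));
    [lin_tac | move=> i; rewrite mxE].
have Gp : G p = S (S a).
  rewrite -[S a](S_Lam1 hopfD Lam_int lam_int lamLam) (sw_map _ _ _ hS_lin).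
  by apply: eq_sw => x y; rewrite pE (linZ hS_lin).
by rewrite -pE -[p](lin_cancel linF linG FK) FE Gp.
Qed.

(** Mirror image of the preceding argument, with [phi |-> phi(Lam_1) S(Lam_2)] as the inverse
    map. *)
Lemma lam_antipode2l a b : hpair lam (a ** b) = hpair lam (S (S b) ** a).
Proof.
pose F b := \row_i hpair lam (b ** e i).
pose G p := sw Lam (fun x y => hpair p x *: S y).
have linF : lin F by apply: (lin_hpair_row lam (F := hmul D)) => y; exact: hmul_linl.
have linG : lin G.
  by rewrite /G; apply: lin_sw => x y; exact: lin_scalel (hpair_linl x).
have FE c x : hpair (F c) x = hpair lam (c ** x).
  by apply: (hpair_row (g := fun x => hpair lam (c ** x)));
    [lin_tac | move=> i; rewrite mxE].
have FK : cancel F G.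
  move=> c; rewrite -[RHS](id_Lam2 hopfD Lam_int lam_int lamLam).
  by apply: eq_sw => x y; rewrite FE.
pose p := \row_i hpair lam (e i ** b).
have pE x : hpair p x = hpair lam (x ** b).
  by apply: (hpair_row (g := fun x => hpair lam (x ** b)));
    [lin_tac | move=> i; rewrite mxE].
have Gp : G p = S (S b).
  rewrite -[S b](S_Lam2 hopfD Lam_int lam_int lamLam) (sw_map _ _ _ hS_lin).
  by apply: eq_sw => x y; rewrite pE (linZ hS_lin).
by rewrite -pE -[p](lin_cancel linF linG FK) FE Gp.
Qed.

Lemma lam_inj b c :
  (forall a, hpair lam (a ** b) = hpair lam (a ** c)) -> b = c.
Proof.
move=> bc; rewrite -(id_Lam1 hopfD Lam_int lam_int lamLam b).
rewrite -[RHS](id_Lam1 hopfD Lam_int lam_int lamLam c).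
by apply: eq_sw => x y; rewrite bc.
Qed.

Lemma antipode4 a : S (S (S (S a))) = a.
Proof.
by apply: lam_inj => b; rewrite -lam_antipode2r -lam_antipode2l.
Qed.

(** Radford's trace formula. Expanding the outer [S] by [S_Lam1] gives
    [p(Lam_1) lam(S(Lam_2) Lam_3)], and the antipode axiom collapses the last two legs. *)
Lemma tr_antipode2_hit p :
  \tr (linmx (fun h => S (S (hit D h p)))) = hpair p Lam * hpair lam (hunit D).
Proof.
transitivity (sw Lam (fun x y => hpair lam (S (hit D x p) ** y) : k^o)).
  rewrite tr_linmx.
  under eq_bigr => l _ do
    rewrite -(S_Lam1 hopfD Lam_int lam_int lamLam (S (hit D _ p))) summxE.
  rewrite exchange_big; apply: eq_bigr => i _ /=.
  under eq_bigr => l _ do rewrite summxE.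
  rewrite exchange_big; apply: eq_bigr => j _ /=.
  have ling : lin (fun h => hpair lam (S (hit D h p) ** e j) : k^o).
    by lin_tac; exact: hit_lin.
  rewrite (lin_basis (e i) ling) scaler_sumr; apply: eq_bigr => l _.
  by rewrite !mxE -[RHS]/(_ * (_ * _)) [(l == i)]eq_sym [X in _ * X]mulrC.
transitivity (sw Lam (fun x y => sw x (fun u v =>
    hpair p u * hpair lam (S v ** y) : k^o))).
  apply: eq_swk => x y; rewrite hit_sw.
  have ling : lin (fun h => hpair lam (S h ** y) : k^o) by lin_tac.
  rewrite (sw_map _ _ _ ling); apply: eq_sw => u v; exact: (linZ ling).
rewrite (sw_assoc hopfD Lam (fun x u v => hpair p x * hpair lam (S u ** v) : k^o)).
transitivity (sw Lam (fun x y => eps y *: (hpair p x * hpair lam (hunit D) : k^o))).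
  apply: eq_swk => x y.
  by rewrite (sw_antil hopfD y (F := fun w => hpair p x * hpair lam w : k^o)) //; lin_tac.
rewrite (sw_counitr hopfD _
  (F := fun x => hpair p x * hpair lam (hunit D) : k^o)) //.
by lin_tac.
Qed.

End Integrals.
End SquareAntipode.

Lemma lfun_lin (k : fieldType) (V W : vectType k) (F : V -> W) x :
  lin F -> linfun F x = F x.
Proof.
move=> linF.
pose G : {linear V -> W} := HB.pack F (GRing.isLinear.Build k V W *:%R F linF).
exact: (lfunE G).
Qed.

(** * The semisimple case: [S^2 = 1], the symmetry of [lam] and [Lam], and the regular trace *)

Section InvolutiveAntipode.
Variables (k : fieldType) (d : nat) (D : hopf_data k d).
Hypotheses (char0 : [pchar k] =i pred0) (hopfD : is_hopf D) (ssD : semisimple D).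
Local Notation H := 'rV[k]_d.
Implicit Types (a b p q : H) (W : lmodType k).
Local Notation e := (hbasis k).
Local Notation eps := (hpair (hcounit D)).
Local Notation sw := (sweedler D).
Local Notation S := (hS D).
Local Infix "**" := (hmul D) (at level 40, left associativity).
Variables Lam lam : H.
Hypotheses (Lam_int : is_integral_H D Lam) (lam_int : is_integral_Hdual D lam).
Hypothesis lamLam : hpair lam Lam = 1.
Hypothesis lam1 : hpair lam (hunit D) = d%:R.

(** For [d = 0] the pairing of [lam] and [Lam] would be an empty sum. *)
Lemma natf_d_neq0 : d%:R != 0 :> k.
Proof.
apply: contra_eq_neq lamLam => /eqP; rewrite (pcharf0P _).1 // => /eqP d0.
rewrite /hpair big1 1?eq_sym ?oner_eq0 // => i _.
by have := ltn_ord i; rewrite [in X in (_ < X)%N]d0.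
Qed.

(** A left ideal complementing the kernel of [eps] contains [v] with [eps(v) = 1] and
    [h v = eps(h) v]. Computing [Lam v] in two ways gives [Lam = eps(Lam) v], and [Lam] is
    nonzero. *)
Lemma eps_Lam_neq0 : eps Lam != 0.
Proof.
have linE : lin (eps : H -> k^o) by exact: hpair_linr.
pose U := lker (linfun (eps : H -> k^o)).
have memU a : (a \in U) = (eps a == 0) by rewrite memv_ker lfun_lin.
have idU : left_ideal D U.
  by move=> a b; rewrite !memU epsM // => /eqP->; rewrite mulr0.
have [V [idV UV UV0]] := ssD idU.
have := memvf (hunit D); rewrite -UV => /memv_addP [u uU [v vV uv]].
have v1 : eps v = 1.
  by move: uU; rewrite memU => /eqP u0; rewrite -(eps1 hopfD) uv (linD linE) u0 add0r.
have hv h : h ** v = eps h *: v.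
  apply/eqP; rewrite -subr_eq0 -memv0 -UV0 memv_cap memU.
  rewrite rpredB ?idV ?memvZ // andbT.
  by rewrite -scaleN1r (linD linE) !hpairZr epsM // v1 !mulr1 mulN1r subrr.
apply: contra_eq_neq lamLam => L0; have := (Lam_int v).2.
rewrite hv L0 scale0r v1 scale1r => <-.
by rewrite (lin0 (@hpair_linr _ _ lam)) eq_sym oner_eq0.
Qed.

Lemma hreg_mulC a b : hpair (hreg D) (a ** b) = hpair (hreg D) (b ** a).
Proof.
have linmxM x y : linmx (hmul D (x ** y)) = linmx (hmul D y) *m linmx (hmul D x).
  rewrite -linmx_comp; last exact: hmul_linr.
  by apply: eq_linmx => z; rewrite hmulA.
by rewrite !hpair_hreg !linmxM mxtrace_mulC.
Qed.

Lemma hreg1 : hpair (hreg D) (hunit D) = d%:R.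
Proof.
rewrite hpair_hreg (linmx_mul (M := 1%:M)) ?mxtrace1 // => a.
by rewrite mulmx1 hmul1l.
Qed.

Lemma hreg_Lam : hpair (hreg D) Lam = eps Lam.
Proof.
rewrite hpair_hreg -(tr_rank1 Lam (@hpair_linr _ _ (hcounit D))); congr (\tr _).
by apply: eq_linmx => a; rewrite (Lam_int a).2.
Qed.

Lemma hit_hit a p q : hit D (hit D a p) q = hit D a (hconv D p q).
Proof. by apply: hpair_ext => r; rewrite !hpair_hit hconvA. Qed.

Lemma hit_counit a : hit D a (hcounit D) = a.
Proof. by apply: hpair_ext => r; rewrite hpair_hit hconv1l. Qed.

Lemma hitZ c a p : hit D a (c *: p) = c *: hit D a p.
Proof.
apply: hpair_ext => r; rewrite hpairZr !hpair_hit.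
by rewrite (linZ (hconv_linl D r)) hpairZl.
Qed.

Let antipode4 := antipode4 hopfD Lam_int lam_int lamLam.
Let S_anti := S_anti hopfD Lam_int lam_int lamLam.
Let sw_S := sw_S hopfD Lam_int lam_int lamLam.
Let tr_antipode2_hit := tr_antipode2_hit hopfD Lam_int lam_int lamLam.

Lemma antipode2_lin : lin (fun a => S (S a)).
Proof. by lin_tac. Qed.

Lemma antipode2_invol : linmx (fun a => S (S a)) *m linmx (fun a => S (S a)) = 1%:M.
Proof.
rewrite -linmx_comp; last exact: antipode2_lin.
by apply: linmx_mul => a; rewrite mulmx1 antipode4.
Qed.

(** [S^2] is an involutive algebra automorphism, so it conjugates left multiplication by [a] into
    left multiplication by [S^2(a)]. *)
Lemma hreg_antipode2 a : hpair (hreg D) (S (S a)) = hpair (hreg D) a.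
Proof.
rewrite !hpair_hreg; pose S2 a := S (S a).
transitivity (\tr (linmx (fun b => S2 (a ** S2 b)))).
  congr (\tr _); apply: eq_linmx => b.
  by rewrite /S2 !S_anti antipode4.
rewrite (linmx_comp (fun b => a ** S2 b) antipode2_lin).
rewrite (linmx_comp S2 (hmul_linr D a)) mxtrace_mulC mulmxA antipode2_invol.
by rewrite mul1mx.
Qed.

Lemma antipode2_hit_hreg a : S (S (hit D a (hreg D))) = hit D (S (S a)) (hreg D).
Proof.
rewrite !hit_sw !sw_S; try by lin_tac.
rewrite (sw_map _ _ _ antipode2_lin); apply: eq_sw => x y.
by rewrite hreg_antipode2 (linZ antipode2_lin).
Qed.

(* Larson and Radford, for semisimple cosemisimple Hopf algebras. *)
Theorem antipode2 a : S (S a) = a.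
Proof.
pose M := linmx (fun a => S (S a)).
pose x := d%:R^-1 *: hreg D; pose E := linmx (fun a => hit D a x).
have linx : lin (fun a => hit D a x) by exact: hit_lin.
have d0 := natf_d_neq0.
have xx : hconv D x x = x.
  rewrite (linZ (hconv_linl D _)) (linZ (hconv_linr D _)) hconv_hreg //.
    by rewrite /= hreg1 !scalerA -mulrA mulVf // mulr1.
  exact: hreg_mulC.
have EE : E *m E = E.
  by rewrite -linmx_comp //; apply: eq_linmx => b; rewrite hit_hit xx.
have EM : E *m M = M *m E.
  rewrite -!linmx_comp //; last exact: antipode2_lin.
  by apply: eq_linmx => b; rewrite !hitZ (linZ antipode2_lin) antipode2_hit_hreg.
have trM : \tr M = eps Lam * d%:R.
  rewrite -lam1 -tr_antipode2_hit; congr (\tr _); apply: eq_linmx => b.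
  by rewrite hit_counit.
have trEM : \tr (E *m M) = d%:R^-1 * \tr M.
  rewrite -linmx_comp; last exact: antipode2_lin.
  by rewrite tr_antipode2_hit hpairZl hreg_Lam lam1 trM mulrA.
have [] := involution_tr char0 antipode2_invol EE EM.
- by rewrite trEM mulVKf.
- by rewrite trM mulf_neq0 ?eps_Lam_neq0.
- by move=> M1; have := mul_linmx a antipode2_lin; rewrite M1 mulmx1.
(* [S^2 = -1] fails at the unit, where [eps] would give [1 = -1]. *)
move=> MN1; have := mul_linmx (hunit D) antipode2_lin.
rewrite MN1 mulmxN mulmx1 !S1 // => /(congr1 eps) /eqP.
rewrite -scaleN1r hpairZr eps1 // mulr1 -subr_eq0 -opprD oppr_eq0.
by rewrite -[1 + 1]/(2%:R) (pcharf0P _).1.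
Qed.

(** With [S^2 = 1], the trace formula at the counit reads [d = eps(Lam) d]. *)
Lemma eps_Lam : eps Lam = 1.
Proof.
have d0 := natf_d_neq0.
have := tr_antipode2_hit (hcounit D); rewrite lam1 => trd.
apply: (mulIf d0); rewrite -trd mul1r (linmx_mul (M := 1%:M)) ?mxtrace1 // => a.
by rewrite mulmx1 antipode2 hit_counit.
Qed.

Lemma lamC a b : hpair lam (a ** b) = hpair lam (b ** a).
Proof. by rewrite (lam_antipode2l hopfD Lam_int lam_int lamLam) antipode2. Qed.

(** Nondegeneracy gives [a] with [x_j = lam(a x)]. The two coefficients are then the [i]-th
    coordinates of [lam(a Lam_2) Lam_1] and, by [lamC], of [lam(Lam_1 a) Lam_2]; both vectors are
    [S(a)]. *)
Lemma hDelta_Lam_sym i j : hDelta D Lam i j = hDelta D Lam j i.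
Proof.
pose F b := \row_i hpair lam (b ** e i).
pose G p := sw Lam (fun x y => hpair p x *: S y).
have linF : lin F by apply: (lin_hpair_row lam (F := hmul D)) => y; exact: hmul_linl.
have linG : lin G.
  by rewrite /G; apply: lin_sw => x y; exact: lin_scalel (hpair_linl x).
have FE c x : hpair (F c) x = hpair lam (c ** x).
  by apply: (hpair_row (g := fun x => hpair lam (c ** x)));
    [lin_tac | move=> l; rewrite mxE].
have FK : cancel F G.
  move=> c; rewrite -[RHS](id_Lam2 hopfD Lam_int lam_int lamLam).
  by apply: eq_sw => x y; rewrite FE.
have GK := lin_cancel linF linG FK; pose a : H := G (e j).
have aE (x : H) : x 0 j = hpair lam (a ** x) by rewrite -FE GK hpair_basisl.
rewrite !hDeltaE; transitivity ((S a) 0 i).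
  rewrite -(S_Lam1 hopfD Lam_int lam_int lamLam) summxE.
  apply: eq_bigr => u _; rewrite summxE; apply: eq_bigr => v _.
  by rewrite aE [RHS]mxE; congr (_ * _); rewrite [RHS]mxE mulrC.
rewrite -(S_Lam2 hopfD Lam_int lam_int lamLam) summxE.
apply: eq_bigr => u _; rewrite summxE; apply: eq_bigr => v _.
by rewrite lamC -aE [LHS]mxE; congr (_ * _); rewrite [LHS]mxE.
Qed.

Lemma sw_LamC W (F : H -> H -> W) : sw Lam F = sw Lam (fun x y => F y x).
Proof.
rewrite /sweedler exchange_big; apply: eq_bigr => i _; apply: eq_bigr => j _.
by rewrite hDelta_Lam_sym.
Qed.

Lemma hconv_LamC p q : hpair (hconv D p q) Lam = hpair (hconv D q p) Lam.
Proof.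
by rewrite !hpair_hconv sw_LamC; apply: eq_swk => x y; rewrite mulrC.
Qed.

(** Left convolution by [p] is the transpose of [h |-> hit D h p]. *)
Lemma tr_hconv p : \tr (linmx (hconv D p)) = d%:R * hpair p Lam.
Proof.
rewrite mulrC -lam1 -tr_antipode2_hit !tr_linmx; apply: eq_bigr => l _.
by rewrite antipode2 -hpair_basisr -hpair_hit hpair_basisl.
Qed.

End InvolutiveAntipode.

(** * Modules and characters *)

Section TensorProduct.
Variable k : fieldType.

Lemma mxtrace_tens m n (A : 'M[k]_m) (B : 'M[k]_n) : \tr (A *t B) = \tr A * \tr B.
Proof.
rewrite /mxtrace mulr_sum; apply: eq_bigr => i _.
by case: (mxtens_indexP i) => i1 i2; rewrite tensmxE mxtens_indexK.
Qed.

Lemma tensmx_linl m n p q (B : 'M[k]_(p, q)) :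
  lin (fun A : 'M[k]_(m, n) => A *t B).
Proof.
move=> c x y; apply/matrixP=> i j.
case: (mxtens_indexP i) => i1 i2; case: (mxtens_indexP j) => j1 j2.
by rewrite !(mxE, tensmxE) !mxtens_indexK /= mulrDl mulrA.
Qed.

Lemma tensmx_linr m n p q (A : 'M[k]_(m, n)) :
  lin (fun B : 'M[k]_(p, q) => A *t B).
Proof.
move=> c x y; apply/matrixP=> i j.
case: (mxtens_indexP i) => i1 i2; case: (mxtens_indexP j) => j1 j2.
by rewrite !(mxE, tensmxE) !mxtens_indexK /= mulrDr mulrCA.
Qed.

Lemma tensmx1 m n : 1%:M *t 1%:M = 1%:M :> 'M[k]_(m * n).
Proof.
apply/matrixP=> i j.
case: (mxtens_indexP i) => i1 i2; case: (mxtens_indexP j) => j1 j2.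
rewrite tensmxE !mxE (can_eq (@mxtens_indexK _ _)) xpair_eqE.
by rewrite -natrM mulnb.
Qed.

Lemma mulmx_linl m n p (B : 'M[k]_(n, p)) : lin (fun A : 'M[k]_(m, n) => A *m B).
Proof. by move=> c x y; rewrite mulmxDl scalemxAl. Qed.

Lemma mulmx_linr m n p (A : 'M[k]_(m, n)) : lin (fun B : 'M[k]_(n, p) => A *m B).
Proof. by move=> c x y; rewrite mulmxDr scalemxAr. Qed.

Lemma mxtrace_lin n : lin (fun A : 'M[k]_n => \tr A : k^o).
Proof. by move=> c x y; rewrite mxtraceD mxtraceZ. Qed.

End TensorProduct.

Section Modules.
Variables (k : fieldType) (d : nat) (D : hopf_data k d).
Hypothesis hopfD : is_hopf D.
Local Notation H := 'rV[k]_d.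
Implicit Types (a b p q : H) (W : lmodType k).
Local Notation e := (hbasis k).
Local Notation eps := (hpair (hcounit D)).
Local Notation sw := (sweedler D).
Local Notation S := (hS D).
Local Infix "**" := (hmul D) (at level 40, left associativity).

Lemma hact_basis n (rho : 'I_d -> 'M[k]_n) i : hact rho (e i) = rho i.
Proof.
rewrite /hact (bigD1 i) //= mxE !eqxx scale1r big1 ?addr0 // => j ji.
by rewrite mxE (negPf ji) andbF scale0r.
Qed.

Lemma hact_fun n (F : H -> 'M[k]_n) a : lin F -> hact (fun i => F (e i)) a = F a.
Proof. by move/lin_basis->. Qed.

Lemma hpair_hchar n (rho : 'I_d -> 'M[k]_n) a : hpair (hchar rho) a = \tr (hact rho a).
Proof.
apply: (hpair_row (g := fun h => \tr (hact rho h))) => [|i].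
  exact: (lin_comp (@mxtrace_lin _ _) (@hact_lin _ _ _ _)).
by rewrite mxE hact_basis.
Qed.

Definition trivial_rep : 'I_d -> 'M[k]_1 := fun i => (eps (e i))%:M.

Lemma trivial_repE a : hact trivial_rep a = (eps a)%:M.
Proof.
apply: (hact_fun (F := fun a => (eps a)%:M)) => c x y.
by rewrite hpair_linr raddfD /=; congr (_ + _); rewrite scale_scalar_mx.
Qed.

Lemma trivial_lmod : is_lmod D trivial_rep.
Proof.
by split=> *; rewrite !trivial_repE ?eps1 // epsM // scalar_mxM.
Qed.

Lemma trivial_char : hchar trivial_rep = hcounit D.
Proof.
by apply: hpair_extl => a; rewrite hpair_hchar trivial_repE mxtrace_scalar.
Qed.

Definition dual_rep n (rho : 'I_d -> 'M[k]_n) i : 'M[k]_n := (hact rho (S (e i)))^T.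

Lemma dual_repE n (rho : 'I_d -> 'M[k]_n) a : hact (dual_rep rho) a = (hact rho (S a))^T.
Proof.
apply: (hact_fun (F := fun a => (hact rho (S a))^T)) => c x y.
by rewrite hS_lin hact_lin linearP.
Qed.

Definition tensor_rep m n (rho : 'I_d -> 'M[k]_m) (sig : 'I_d -> 'M[k]_n) i :
    'M[k]_(m * n) :=
  sw (e i) (fun x y => hact rho x *t hact sig y).

Lemma tensor_repE m n (rho : 'I_d -> 'M[k]_m) (sig : 'I_d -> 'M[k]_n) a :
  hact (tensor_rep rho sig) a = sw a (fun x y => hact rho x *t hact sig y).
Proof.
by apply: (hact_fun (F := fun a => sw a (fun x y => hact rho x *t hact sig y)));
  exact: sw_lin.
Qed.

Section Tensor.
Variables (m n : nat) (rho : 'I_d -> 'M[k]_m) (sig : 'I_d -> 'M[k]_n).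

Let linl y : lin (fun x => hact rho x *t hact sig y).
Proof. exact: lin_comp (tensmx_linl _) (@hact_lin _ _ _ _). Qed.

Let linr x : lin (fun y => hact rho x *t hact sig y).
Proof. exact: lin_comp (tensmx_linr _) (@hact_lin _ _ _ _). Qed.

Lemma tensor_lmod : is_lmod D rho -> is_lmod D sig -> is_lmod D (tensor_rep rho sig).
Proof.
move=> [rhoM rho1] [sigM sig1]; split=> [a b|].
  rewrite !tensor_repE sw_mul // (sw_map _ _ _ (mulmx_linl _)).
  apply: eq_sw => x y; rewrite (sw_map _ _ _ (mulmx_linr _)).
  by apply: eq_sw => z t; rewrite rhoM sigM tensmx_mul.
by rewrite tensor_repE sw_one // rho1 sig1 tensmx1.
Qed.

Lemma tensor_char : hchar (tensor_rep rho sig) = hconv D (hchar rho) (hchar sig).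
Proof.
apply: hpair_extl => a; rewrite hpair_hchar tensor_repE (sw_map _ _ _ (@mxtrace_lin _ _)).
rewrite hpair_hconv; apply: eq_swk => x y.
by rewrite mxtrace_tens !hpair_hchar.
Qed.

End Tensor.

(** Covers submodules and quotients at once: the projection [C *m A] may be inserted if the columns
    of [C] span a submodule, and also if the kernel of [A] is one. *)
Lemma compressed_lmod m r (rho : 'I_d -> 'M[k]_m) (A : 'M_(r, m)) (C : 'M_(m, r)) :
  is_lmod D rho -> A *m C = 1%:M ->
  (forall a b, A *m hact rho a *m (C *m A) *m hact rho b *m C =
     A *m hact rho a *m hact rho b *m C) ->
  is_lmod D (fun i => A *m rho i *m C).
Proof.
move=> [rhoM rho1] AC AA.
have actE a : hact (fun i => A *m rho i *m C) a = A *m hact rho a *m C.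
  have linF : lin (fun a => A *m hact rho a *m C).
    by move=> c x y; rewrite hact_lin mulmxDr mulmxDl -scalemxAr -scalemxAl.
  rewrite -[RHS](hact_fun a linF); apply: eq_bigr => i _.
  by rewrite hact_basis.
split=> [a b|]; rewrite !actE; last by rewrite rho1 mulmx1.
by rewrite rhoM !mulmxA -AA !mulmxA.
Qed.

Lemma lmod_iso_char m n (rho : 'I_d -> 'M[k]_m) (sig : 'I_d -> 'M[k]_n) :
  lmod_iso rho sig -> hchar rho = hchar sig.
Proof.
move=> [P [Pfree Pfull rhoP]]; apply: hpair_extl => a; rewrite !hpair_hchar.
rewrite -[hact rho a]mulmx1 -(mulmxVp Pfree) mulmxA rhoP mxtrace_mulC mulmxA.
by rewrite mulVpmx // mul1mx.
Qed.

(** Induction on the dimension: the character of a reducible module is the sum of those of a proper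
    nonzero submodule and its quotient. *)
Lemma char_ind (R : {vspace H}) :
  (forall m (rho : 'I_d -> 'M[k]_m),
     is_lmod D rho -> lmod_irreducible rho -> hchar rho \in R) ->
  forall m (rho : 'I_d -> 'M[k]_m), is_lmod D rho -> hchar rho \in R.
Proof.
move=> irrR m; elim/ltn_ind: m => m IHm rho lrho.
have [m0|m_gt0] := posnP m.
  suff -> : hchar rho = 0 by rewrite mem0v.
  apply/rowP=> i; rewrite !mxE /mxtrace big1 // => j _.
  by have := ltn_ord j; rewrite [in X in (_ < X)%N]m0.
case: (classic (lmod_irreducible rho)) => [|nirr]; first exact: irrR.
have [W [invW W0 Wfull]] : exists W : 'M[k]_m,
    [/\ forall h, (W *m (hact rho h)^T <= W)%MS, W != 0 & ~~ row_full W].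
  apply: NNPP => nW; apply: nirr; split=> // W invW.
  have [->|W0] := eqVneq W 0; first by left.
  right; apply: contraT => Wfull; case: nW; by exists W.
have [r [B [B' [rm BB' B'K BW]]]] : exists r (B : 'M[k]_(r, m)) (B' : 'M[k]_(m, r)),
    [/\ (r < m)%N, B *m B' = 1%:M,
      forall X : 'M_(r, m), (X <= B)%MS -> X *m B' *m B = X & (B :=: W)%MS].
  exists (\rank W), (row_base W), (pinvmx (row_base W)); split=> [|||].
  - by rewrite ltn_neqAle rank_leq_col andbT.
  - by rewrite mulmxVp ?row_base_free.
  - by move=> X /mulmxKpV.
  - exact: eq_row_base.
(* Back to column vectors: the columns of [C] span the submodule, and [A] is a left inverse of
   [C]. *)
pose C := B^T; pose A := B'^T.
have AC : A *m C = 1%:M by rewrite -trmx_mul BB' trmx1.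
have CAC a : C *m A *m hact rho a *m C = hact rho a *m C.
  apply: trmx_inj; rewrite /C /A !trmx_mul !trmxK !mulmxA B'K //.
  by rewrite (eqmxMr _ BW); apply: submx_trans (invW a) _; rewrite BW.
(* The kernel of [P] is the submodule, so its rank factorization [C2 *m A2] models the quotient. *)
pose P := 1%:M - C *m A.
have PP : P *m P = P.
  rewrite /P mulmxBl mul1mx mulmxBr mulmx1 mulmxA -(mulmxA C A C) AC mulmx1.
  by rewrite subrr subr0.
have [s [A2 [C2 [sP AC2 CA2]]]] : exists s (A2 : 'M[k]_(s, m)) (C2 : 'M[k]_(m, s)),
    [/\ s = \rank P, A2 *m C2 = 1%:M & C2 *m A2 = P].
  exists (\rank P), (row_base P), (col_base P).
  by rewrite mulmx_base idempotent_factor.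
have A2C : A2 *m C = 0.
  rewrite -[LHS]mul1mx -AC2 -!mulmxA (mulmxA C2) CA2 /P mulmxBl mul1mx.
  by rewrite -mulmxA AC mulmx1 subrr mulmx0.
have -> : hchar rho =
    hchar (fun i => A *m rho i *m C) + hchar (fun i => A2 *m rho i *m C2).
  apply/rowP=> i; rewrite !mxE.
  rewrite [X in _ = X + _]mxtrace_mulC [X in _ = _ + X]mxtrace_mulC !mulmxA CA2 -mxtraceD.
  by rewrite -mulmxDl /P addrC subrK mul1mx.
apply: rpredD; apply: IHm.
- exact: rm.
- apply: compressed_lmod => // a b.
  by rewrite -!mulmxA; congr (_ *m (_ *m _)); rewrite !mulmxA CAC.
(* The quotient is smaller: full rank would give [P = 1], hence [C *m A = 0] and [W = 0]. *)
- rewrite sP ltn_neqAle rank_leq_row andbT; apply: contra_neq W0 => Pfull.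
  have Pu : P \in unitmx by rewrite -row_free_unit /row_free Pfull.
  have : P = 1%:M by rewrite -[LHS](mulKmx Pu) PP mulVmx.
  move/eqP; rewrite /P subr_eq addrC -subr_eq subrr eq_sym => /eqP CA0.
  have /(congr1 trmx) : C = 0 by rewrite -[C]mulmx1 -AC mulmxA CA0 mul0mx.
  rewrite trmxK trmx0 => B0; apply/eqP; rewrite -submx0 -BW B0.
  by rewrite submx0.
apply: compressed_lmod => // a b.
rewrite CA2 /P mulmxBr mulmx1 mulmxBl mulmxBl -[RHS]subr0; congr (_ - _).
rewrite -!mulmxA (mulmxA (hact rho a)) -(CAC a) !mulmxA A2C !mul0mx //.
Qed.

(** Invariant subspaces are row spaces of transposed vectors, so the image and kernel of [P] on
    columns appear as the row space of [P^T] and [kermx P^T]. *)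
Lemma schur m n (rho : 'I_d -> 'M[k]_m) (sig : 'I_d -> 'M[k]_n) (P : 'M[k]_(m, n)) :
  lmod_irreducible rho -> lmod_irreducible sig ->
  (forall h, hact rho h *m P = P *m hact sig h) -> P = 0 \/ row_free P /\ row_full P.
Proof.
move=> [_ irho] [_ isig] PI.
have [|W0|Wfull] := irho <<P^T>>%MS.
- move=> h; rewrite !(eqmxMr _ (genmxE _)) genmxE -trmx_mul PI trmx_mul.
  exact: submxMl.
- left; apply: trmx_inj; apply/eqP; rewrite trmx0 -submx0 -(genmxE P^T) W0.
  by rewrite submx0.
have Pfree : row_free P.
  by move: Wfull; rewrite /row_full /row_free genmxE mxrank_tr.
have [|K0|Kfull] := isig (kermx P^T).
- move=> h; apply/sub_kermxP.
  by rewrite -mulmxA -trmx_mul -PI trmx_mul mulmxA mulmx_ker mul0mx.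
- right; split => //.
  by rewrite /row_full -mxrank_tr -[_ == _]/(row_free P^T) -kermx_eq0 K0.
left; apply: trmx_inj; rewrite trmx0; apply: (row_full_inj Kfull).
by rewrite mulmx_ker mulmx0.
Qed.

End Modules.

(** * Orthogonality relations *)

Section Orthogonality.
Variables (k : closedFieldType) (d : nat) (D : hopf_data k d).
Hypotheses (char0 : [pchar k] =i pred0) (hopfD : is_hopf D) (ssD : semisimple D).
Local Notation H := 'rV[k]_d.
Implicit Types (a b p q : H) (W : lmodType k).
Local Notation e := (hbasis k).
Local Notation eps := (hpair (hcounit D)).
Local Notation sw := (sweedler D).
Local Notation S := (hS D).
Local Infix "**" := (hmul D) (at level 40, left associativity).
Variables Lam lam : H.
Hypotheses (Lam_int : is_integral_H D Lam) (lam_int : is_integral_Hdual D lam).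
Hypothesis lamLam : hpair lam Lam = 1.
Hypothesis lam1 : hpair lam (hunit D) = d%:R.

Let antipode2 := antipode2 char0 hopfD ssD Lam_int lam_int lamLam lam1.
Let S_anti := S_anti hopfD Lam_int lam_int lamLam.
Let sw_LamC := sw_LamC char0 hopfD ssD Lam_int lam_int lamLam lam1.

Lemma schur_scalar n (rho : 'I_d -> 'M[k]_n) (P : 'M[k]_n) :
  lmod_irreducible rho -> (forall h, hact rho h *m P = P *m hact rho h) ->
  is_scalar_mx P.
Proof.
move=> irr PI; have n0 := proj1 irr.
have /closed_rootP [c] : size (char_poly P) != 1%N.
  by rewrite size_char_poly eqSS -lt0n.
rewrite -eigenvalue_root_char => /eigenvalueP [v vP v0].
have PcI h : hact rho h *m (P - c%:M) = (P - c%:M) *m hact rho h.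
  by rewrite mulmxBr mulmxBl PI scalar_mxC.
have [/eqP|[Pc_free _]] := schur irr irr PcI.
  by rewrite subr_eq0 => /eqP->; exact: scalar_mx_is_scalar.
case/eqP: v0; apply: (row_free_inj Pc_free).
by rewrite mul0mx mulmxBr vP mul_mx_scalar subrr.
Qed.

(** For a group algebra this is the mean of [g M g^-1] over the group. *)
Definition average m n (rho : 'I_d -> 'M[k]_m) (sig : 'I_d -> 'M[k]_n)
    (M : 'M[k]_(m, n)) : 'M[k]_(m, n) :=
  sw Lam (fun x y => hact rho x *m M *m hact sig (S y)).

(** [sw_Lam] carries [h] across [Lam] as [S(h)]; the antipode on the other leg makes it
    [S(S(h)) = h] and, being antimultiplicative, places it on the far right. *)
Lemma average_intertwines m n (rho : 'I_d -> 'M[k]_m) (sig : 'I_d -> 'M[k]_n) M h :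
  is_lmod D rho -> is_lmod D sig ->
  hact rho h *m average rho sig M = average rho sig M *m hact sig h.
Proof.
move=> [rhoM _] [sigM _].
pose F x y := hact rho y *m M *m hact sig (S x).
have linF1 y : lin (fun x => F x y).
  by apply: lin_comp (mulmx_linr _) (lin_comp (@hact_lin _ _ _ _) hS_lin).
have linF2 x : lin (F x).
  by move=> c y z; rewrite /F hact_lin !mulmxDl -!scalemxAl.
rewrite /average (sw_map _ _ _ (mulmx_linr _)) (sw_map _ _ _ (mulmx_linl _)).
transitivity (sw Lam (fun x y => F x (h ** y))).
  by rewrite sw_LamC; apply: eq_sw => x y; rewrite /F rhoM !mulmxA.
rewrite (sw_Lam hopfD Lam_int h linF1 linF2) sw_LamC; apply: eq_sw => x y.
by rewrite /F S_anti antipode2 sigM !mulmxA.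
Qed.

(** Cyclicity of the trace and symmetry of [Lam] produce [S(Lam_1) Lam_2], which is
    [eps(Lam) 1 = 1]. *)
Lemma tr_average n (rho : 'I_d -> 'M[k]_n) M :
  is_lmod D rho -> \tr (average rho rho M) = \tr M.
Proof.
move=> [rhoM rho1].
have linT : lin (fun a => \tr (M *m hact rho a) : k^o).
  by move=> c x y; rewrite hact_lin mulmxDr -scalemxAr mxtraceD mxtraceZ.
transitivity (sw Lam (fun x y => \tr (M *m hact rho (S x ** y)) : k^o)).
  rewrite /average (sw_map _ _ _ (@mxtrace_lin _ _)) sw_LamC; apply: eq_swk => x y.
  by rewrite -mulmxA mxtrace_mulC -mulmxA -rhoM.
rewrite (sw_antil hopfD Lam linT).
by rewrite (eps_Lam char0 hopfD ssD Lam_int lam_int lamLam lam1) scale1r rho1 mulmx1.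
Qed.

(** Averaging a matrix unit isolates the product of diagonal entries
    [rho_ii(Lam_1) sig_jj(S(Lam_2))]. This is how Schur's lemma reaches characters. *)
Lemma average_delta m n (rho : 'I_d -> 'M[k]_m) (sig : 'I_d -> 'M[k]_n) :
  \sum_i \sum_j average rho sig (delta_mx i j) i j =
  hpair (hconv D (hchar rho) (hchar (dual_rep D sig))) Lam.
Proof.
have avgE i j : average rho sig (delta_mx i j) i j =
    sw Lam (fun x y => hact rho x i i * hact sig (S y) j j : k^o).
  rewrite summxE; apply: eq_bigr => u _; rewrite summxE; apply: eq_bigr => v _.
  rewrite mxE; congr (_ * _); rewrite mxE (bigD1 j) //= big1 => [|l lj]; last first.
    rewrite mxE big1 ?mul0r // => l' _.
    by rewrite mxE (negPf lj) andbF mulr0.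
  rewrite addr0 mxE (bigD1 i) //= big1 => [|l li].
    by rewrite mxE !eqxx mulr1 addr0.
  by rewrite mxE (negPf li) mulr0.
rewrite hpair_hconv.
transitivity (\sum_i (sw Lam (fun x y =>
    \sum_j hact rho x i i * hact sig (S y) j j : k^o) : k)).
  by apply: eq_bigr => i _; rewrite -sw_sumk; apply: eq_bigr => j _.
rewrite sw_sumk; apply: eq_swk => x y.
rewrite !hpair_hchar dual_repE mxtrace_tr /mxtrace mulr_suml.
by apply: eq_bigr => i _; rewrite mulr_sumr.
Qed.

Lemma char_orthogonal m n (rho : 'I_d -> 'M[k]_m) (sig : 'I_d -> 'M[k]_n) :
  is_lmod D rho -> is_lmod D sig -> lmod_irreducible rho -> lmod_irreducible sig ->
  ~ lmod_iso rho sig ->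
  hpair (hconv D (hchar rho) (hchar (dual_rep D sig))) Lam = 0.
Proof.
move=> lrho lsig irho isig niso; rewrite -average_delta.
apply: big1 => i _; apply: big1 => j _.
have avgI h := average_intertwines (delta_mx i j) h lrho lsig.
have [->|[afree afull]] := schur irho isig avgI; first by rewrite mxE.
by case: niso; exists (average rho sig (delta_mx i j)).
Qed.

Lemma char_norm n (rho : 'I_d -> 'M[k]_n) :
  is_lmod D rho -> lmod_irreducible rho ->
  hpair (hconv D (hchar rho) (hchar (dual_rep D rho))) Lam = 1.
Proof.
move=> lrho irho; rewrite -average_delta.
have n0 : n%:R != 0 :> k by rewrite (pcharf0P _).1 // -lt0n; exact: proj1 irho.
(* The average is a scalar matrix with the trace of the matrix unit, so its scalar is that trace
   divided by [n]. *)
have avgE i j : average rho rho (delta_mx i j) i j = (i == j)%:R / n%:R.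
  have /is_scalar_mxP [c cE] := schur_scalar irho
    (fun h => average_intertwines (delta_mx i j) h lrho lrho).
  have := tr_average (delta_mx i j) lrho; rewrite cE mxtrace_scalar => trE.
  have {trE}cn : c * n%:R = (i == j)%:R.
    rewrite mulr_natr trE /mxtrace (bigD1 i) //= big1 => [|l li].
      by rewrite mxE eqxx addr0.
    by rewrite mxE (negPf li).
  rewrite mxE -cn mulfK //; case: eqP cn => // _ /eqP.
  by rewrite mulf_eq0 (negPf n0) orbF => /eqP->.
under eq_bigr => i _ do under eq_bigr => j _ do rewrite avgE.
transitivity (\sum_(i < n) n%:R^-1 : k).
  apply: eq_bigr => i _; rewrite (bigD1 i) //= eqxx mul1r big1 ?addr0 // => j ji.
  by rewrite eq_sym (negPf ji) mul0r.
by rewrite sumr_const card_ord -[LHS]mulr_natr mulVf.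
Qed.

Lemma dual_lmod n (rho : 'I_d -> 'M[k]_n) : is_lmod D rho -> is_lmod D (dual_rep D rho).
Proof.
move=> [rhoM rho1]; split=> [a b|]; rewrite !dual_repE.
  by rewrite S_anti rhoM trmx_mul.
by rewrite S1 // rho1 trmx1.
Qed.

(** * Closure of [R(H)] under convolution, and its nondegenerate form *)

Section CharacterAlgebra.
Variables (n : nat) (dV : 'I_n -> nat) (V : forall i : 'I_n, 'I_d -> 'M[k]_(dV i)).
Hypotheses (V_irr : forall i, is_lmod D (V i) /\ lmod_irreducible (V i))
  (V_noniso : forall i j, lmod_iso (V i) (V j) -> i = j)
  (V_all : forall m (rho : 'I_d -> 'M[k]_m),
      is_lmod D rho -> lmod_irreducible rho -> exists i, lmod_iso rho (V i)).
Local Notation RH := (<<[seq hchar (V i) | i : 'I_n]>>)%VS.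

Lemma char_in_RH m (rho : 'I_d -> 'M[k]_m) : is_lmod D rho -> hchar rho \in RH.
Proof.
move: m rho; apply: char_ind => m rho lrho irho.
have [i /lmod_iso_char->] := V_all lrho irho.
by apply: memv_span; apply: image_f.
Qed.

Lemma RH_sum x : x \in RH -> exists c : 'I_n -> k, x = \sum_i c i *: hchar (V i).
Proof.
rewrite span_def big_image => /memv_sumP [v vV ->].
have /fin_all_exists [c cE] i : exists c, v i = c *: hchar (V i).
  by have /vlineP [c ->] := vV i isT; exists c.
by exists c; apply: eq_bigr.
Qed.

Lemma RH_hcounit : hcounit D \in RH.
Proof. by rewrite -trivial_char; apply/char_in_RH/trivial_lmod. Qed.

Lemma RH_hconv x y : x \in RH -> y \in RH -> hconv D x y \in RH.
Proof.
move=> /RH_sum [c ->] /RH_sum [c' ->].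
rewrite (lin_sum (hconv_linl D _)); apply: rpred_sum => i _.
rewrite (linZ (hconv_linl D _)) (lin_sum (hconv_linr D _)); apply: rpredZ.
apply: rpred_sum => j _; rewrite (linZ (hconv_linr D _)); apply: rpredZ.
rewrite -tensor_char; apply: char_in_RH.
by apply: tensor_lmod => //; [case: (V_irr i) | case: (V_irr j)].
Qed.

(** By orthogonality, testing against the dual character of [V j] reads off the coefficient of [x]
    at [hchar (V j)]. *)
Lemma RH_nondegenerate x : x \in RH ->
  (forall y, y \in RH -> hpair (hconv D x y) Lam = 0) -> x = 0.
Proof.
move=> /RH_sum [c ->] x0; apply: big1 => j _.
have [lVj irVj] := V_irr j.
have := x0 _ (char_in_RH (dual_lmod lVj)).
have linP : lin (fun x => hpair (hconv D x (hchar (dual_rep D (V j)))) Lam : k^o).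
  by apply: lin_comp (hpair_linl _) (hconv_linl _ _).
rewrite (lin_sum linP) (bigD1 j) //= big1 => [|i ij]; last first.
  have [lVi irVi] := V_irr i.
  rewrite (linZ linP) char_orthogonal ?scaler0 // => /V_noniso ji.
  by rewrite ji eqxx in ij.
rewrite (linZ linP) char_norm // addr0 -[_ *: _]/(_ * _) mulr1 => ->.
by rewrite scale0r.
Qed.

End CharacterAlgebra.
End Orthogonality.

(** * Primitive idempotents of the character algebra *)

(** With [M = C R] a rank factorization, [C (R C) R = 0] forces [R C = 0], whose trace is that of
    [M]. *)
Lemma tr_square_zero (k : fieldType) n (M : 'M[k]_n) : M *m M = 0 -> \tr M = 0.
Proof.
move=> MM; rewrite -(mulmx_base M) mxtrace_mulC.
suff -> : row_base M *m col_base M = 0 by rewrite mxtrace0.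
apply: (row_free_inj (row_base_free M)); apply: (row_full_inj (col_base_full M)).
by rewrite mul0mx mulmx0 -(mulmxA (row_base M)) mulmx_base mulmxA mulmx_base.
Qed.

Lemma eigenvector_in (k : closedFieldType) (vT : vectType k) (U : {vspace vT})
    (g : vT -> vT) :
  lin g -> (forall v, v \in U -> g v \in U) -> U != 0%VS ->
  exists c v, [/\ v \in U, v != 0 & g v = c *: v].
Proof.
move=> ling gU U0; have m0 : (0 < \dim U)%N by rewrite lt0n dimv_eq0.
pose b := vbasis U; pose A : 'M_(\dim U) := \matrix_(i, j) coord b j (g b`_i).
have bU (i : 'I_(\dim U)) : b`_i \in U by apply/vbasis_mem/mem_nth; rewrite size_tuple.
have /closed_rootP [c] : size (char_poly A) != 1%N.
  by rewrite size_char_poly eqSS -lt0n.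
rewrite -eigenvalue_root_char => /eigenvalueP [a aA a0].
exists c, (\sum_i a 0 i *: b`_i); split.
- by apply: rpred_sum => i _; apply: rpredZ.
- apply: contra_neq a0 => v0; apply/rowP=> i; rewrite mxE.
  by have /freeP/(_ (a 0) v0) := basis_free (vbasisP U).
rewrite (lin_sum ling).
under eq_bigr => i _ do rewrite (linZ ling) (coord_vbasis (gU _ (bU i))) scaler_sumr.
rewrite exchange_big scaler_sumr; apply: eq_bigr => j _ /=.
have /rowP/(_ j) := aA; rewrite !mxE => acj.
rewrite scalerA -acj scaler_suml; apply: eq_bigr => i _.
by rewrite mxE scalerA.
Qed.

Lemma sub_trace_id (k : fieldType) d (U : {vspace 'rV[k]_d}) g :
  (forall x, x \in U -> g x = x) -> sub_trace U g = (\dim U)%:R.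
Proof.
move=> gid; rewrite /sub_trace.
transitivity (\sum_(i < \dim U) 1 : k); last by rewrite sumr_const card_ord.
apply: eq_bigr => i _; rewrite gid; last first.
  by apply/vbasis_mem/mem_nth; rewrite size_tuple.
by rewrite coord_free ?eqxx // (basis_free (vbasisP U)).
Qed.

Lemma dim_img_idempotent (k : fieldType) d (F : 'rV[k]_d -> 'rV[k]_d) :
  lin F -> (forall p, F (F p) = F p) ->
  (\dim (linfun F @: fullv)%VS)%:R = \tr (linmx F).
Proof.
move=> linF FF; pose M := linmx F.
have MM : M *m M = M by rewrite -linmx_comp //; apply: eq_linmx.
rewrite (tr_idempotent MM); congr (_%:R).
have linB : lin (fun u : 'rV_(\rank M) => u *m row_base M) by exact: mulmx_linl.
have -> : (linfun F @: fullv =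
    linfun (fun u : 'rV_(\rank M) => u *m row_base M) @: fullv)%VS.
  apply/eqP; rewrite eqEsubv; apply/andP; split; apply/subvP => _ /memv_imgP [u _ ->].
    apply/memv_imgP; exists (u *m col_base M); first exact: memvf.
    by rewrite !lfun_lin // -mulmxA mulmx_base mul_linmx.
  apply/memv_imgP; exists (u *m row_base M); first exact: memvf.
  have : row_base M *m (col_base M *m row_base M) = row_base M.
    by rewrite (mulmxA (row_base M)) idempotent_factor // mul1mx.
  by rewrite mulmx_base => bM; rewrite !lfun_lin // -(mul_linmx _ linF) -mulmxA bM.
rewrite limg_dim_eq ?dimvf; first by rewrite /dim /= mul1n.
apply/eqP; rewrite -subv0; apply/subvP => u; rewrite memv_cap memv_ker lfun_lin //.
case/andP=> _ /eqP u0; rewrite memv0; apply/eqP.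
by apply: (row_free_inj (row_base_free M)); rewrite u0 mul0mx.
Qed.

Section PrimitiveIdempotent.
Variables (k : closedFieldType) (d : nat) (D : hopf_data k d).
Hypotheses (char0 : [pchar k] =i pred0) (hopfD : is_hopf D).
Local Notation H := 'rV[k]_d.
Local Infix "**" := (hconv D) (at level 40, left associativity).
Variables (R : {vspace H}) (Lam : H).
Local Notation t p := (hpair p Lam).
Hypothesis RM : forall x y, x \in R -> y \in R -> x ** y \in R.
Hypothesis tC : forall p q, t (p ** q) = t (q ** p).
Hypothesis tr_t : forall p, \tr (linmx (hconv D p)) = d%:R * t p.
Hypothesis t_nondeg : forall x, x \in R ->
  (forall y, y \in R -> t (x ** y) = 0) -> x = 0.
Hypothesis d_neq0 : d%:R != 0 :> k.

Let mulA p q r : p ** q ** r = p ** (q ** r).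
Proof. exact: hconvA. Qed.

Let mul0r p : 0 ** p = 0.
Proof. exact: lin0 (hconv_linl D p). Qed.

Let mulr0 p : p ** 0 = 0.
Proof. exact: lin0 (hconv_linr D p). Qed.

Let mulZl c p q : (c *: p) ** q = c *: (p ** q).
Proof. exact: linZ (hconv_linl D q) _ _. Qed.

Let mulZr c p q : p ** (c *: q) = c *: (p ** q).
Proof. exact: linZ (hconv_linr D p) _ _. Qed.

Let mulBl p q r : (p - q) ** r = p ** r - q ** r.
Proof. by rewrite -!scaleN1r (linD (hconv_linl D r)) mulZl. Qed.

Let mulBr p q r : r ** (p - q) = r ** p - r ** q.
Proof. by rewrite -!scaleN1r (linD (hconv_linr D r)) mulZr. Qed.

Let mul_suml (I : finType) (F : I -> H) p : (\sum_i F i) ** p = \sum_i F i ** p.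
Proof. by rewrite (lin_sum (hconv_linl D p)). Qed.

Let mul_sumr (I : finType) (F : I -> H) p : p ** (\sum_i F i) = \sum_i p ** F i.
Proof. by rewrite (lin_sum (hconv_linr D p)). Qed.

Let lint : lin (fun p => t p : k^o).
Proof. exact: hpair_linl. Qed.

Lemma t_square_zero x : x ** x = 0 -> t x = 0.
Proof.
move=> xx; apply/eqP; rewrite -(mulrI_eq0 _ (mulfI d_neq0)) -tr_t tr_square_zero //.
rewrite -linmx_comp; last exact: hconv_linr.
by apply/row_matrixP => i; rewrite rowK row0 -mulA xx mul0r.
Qed.

(** The Gram matrix of the form on a basis of [R] is invertible by [t_nondeg]; the representing
    vector solves the resulting linear system. *)
Lemma t_represent (phi : H -> k^o) : lin phi ->
  exists2 w, w \in R & forall y, y \in R -> phi y = t (y ** w).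
Proof.
move=> linphi; pose b := vbasis R.
have bR (i : 'I_(\dim R)) : b`_i \in R by apply/vbasis_mem/mem_nth; rewrite size_tuple.
pose G : 'M_(\dim R) := \matrix_(i, j) t (b`_i ** b`_j).
have Gu : G \in unitmx.
  rewrite -row_free_unit; apply: inj_row_free => v vG.
  have x0 : \sum_i v 0 i *: b`_i = 0.
    apply: t_nondeg => [|y yR]; first by apply: rpred_sum => i _; exact: rpredZ.
    rewrite (coord_vbasis yR) mul_sumr (lin_sum lint); apply: big1 => j _.
    rewrite mulZr (linZ lint) mul_suml (lin_sum lint).
    have /rowP/(_ j) := vG; rewrite !mxE => vGj.
    rewrite (eq_bigr (fun i => v 0 i * G i j)) ?vGj ?scaler0 // => i _.
    by rewrite mulZl (linZ lint) mxE.
  apply/rowP=> i; rewrite mxE.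
  by have /freeP/(_ (v 0) x0) := basis_free (vbasisP R).
pose s := invmx G *m \col_i phi b`_i.
exists (\sum_j s j 0 *: b`_j); first by apply: rpred_sum => i _; exact: rpredZ.
move=> y yR; rewrite (coord_vbasis yR) (lin_sum linphi) mul_suml (lin_sum lint).
apply: eq_bigr => i _; rewrite (linZ linphi) mulZl (linZ lint); congr (_ *: _).
rewrite mul_sumr (lin_sum lint); have := mulKVmx Gu (\col_i phi b`_i).
move/matrixP/(_ i 0); rewrite mxE [RHS]mxE => <-; apply: eq_bigr => j _.
by rewrite mulZr (linZ lint) mxE mulrC.
Qed.

Variable f : H.
Hypothesis f_prim : primitive_idem D R f.

Let fR : f \in R. Proof. by case: f_prim. Qed.
Let f0 : f != 0. Proof. by case: f_prim. Qed.
Let ff : f ** f = f. Proof. by case: f_prim. Qed.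

(** Otherwise [f = u + (f - u)] splits [f] into orthogonal idempotents. *)
Lemma primitive_sub_idem u : u \in R -> u ** u = u -> f ** u = u -> u ** f = u ->
  u != 0 -> u = f.
Proof.
move=> uR uu fu uf u0; apply/eqP; rewrite eq_sym -subr_eq0; apply: contraT => fu0.
have [_ _ _ /(_ u (f - u))] := f_prim; case=> //.
- by rewrite rpredB.
- by rewrite /idem mulBl !mulBr ff uu fu uf subrr subr0.
- by rewrite mulBr uu uf subrr.
- by rewrite mulBl uu fu subrr.
by rewrite addrC subrK.
Qed.

(* If [t x != 0] for some [x] in [I] then [x ** x != 0], so the right ideal
   [x ** I] is nonzero; either it is smaller than [I], or left multiplication by
   [x] is bijective on [I] and the [u] with [x ** u = x] is idempotent. *)
Lemma right_ideal_contains (I : {vspace H}) :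
  (I <= R)%VS -> (forall x, x \in I -> f ** x = x) ->
  (forall x y, x \in I -> y \in R -> x ** y \in I) -> I != 0%VS -> f \in I.
Proof.
move: {2}_.+1 (ltnSn (\dim I)) => m; elim: m I => // m IHm I dimI IR fI Iideal I0.
have [x xI tx] : exists2 x, x \in I & t x != 0.
  apply: NNPP => nx; case/eqP: I0; apply/eqP; rewrite -subv0; apply/subvP => x xI.
  rewrite memv0; apply/eqP/t_nondeg => [|y yR]; first exact: (subvP IR).
  by apply/eqP/contraT => txy; case: nx; exists (x ** y); rewrite ?Iideal.
have linx : lin (hconv D x) by exact: hconv_linr.
have xxE : linfun (hconv D x) x = x ** x by exact: lfun_lin.
pose J := (linfun (hconv D x) @: I)%VS.
have JI : (J <= I)%VS.
  by apply/subvP => _ /memv_imgP [y yI ->]; rewrite lfun_lin // Iideal // (subvP IR).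
have xx0 : x ** x != 0 by apply: contra_neq tx; exact: t_square_zero.
have xxJ : x ** x \in J by rewrite -xxE memv_img.
have [dimJ|dimJ] := ltnP (\dim J) (\dim I).
  apply: (subvP JI); apply: IHm.
  - exact: leq_trans dimJ _.
  - exact: subv_trans JI IR.
  - by move=> y yJ; rewrite fI // (subvP JI).
  - move=> _ z /memv_imgP [y yI ->] zR; rewrite lfun_lin // mulA.
    by rewrite -(lfun_lin _ linx) memv_img ?Iideal.
  by apply: contra_neq xx0 => J0; apply/eqP; rewrite -memv0 -J0.
have JE : J = I by apply/eqP; rewrite eqEdim JI.
have injx y : y \in I -> x ** y = 0 -> y = 0.
  move=> yI xy; apply/eqP; rewrite -memv0.
  have := limg_ker_dim (linfun (hconv D x)) I; rewrite -/J JE => /eqP.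
  rewrite -[X in _ == X]add0n eqn_add2r dimv_eq0 => /eqP <-.
  by rewrite memv_cap yI memv_ker lfun_lin // xy eqxx.
have /memv_imgP [u uI] : x \in J by rewrite JE.
rewrite lfun_lin // => xu.
have uR : u \in R by exact: (subvP IR).
(* From [x ** u = x], [x] annihilates [u ** u - u], and left multiplication by [x] is injective on
   [I]. *)
have uu : u ** u = u.
  apply/eqP; rewrite -subr_eq0; apply/eqP/injx; first by rewrite rpredB ?Iideal.
  by rewrite mulBr -mulA -!xu subrr.
have u0 : u != 0 by apply: contra_neq tx => u0; rewrite xu u0 mulr0 (lin0 lint).
have fu := fI _ uI.
(* [u] is fixed by [f] on the left only; [u ** f] is idempotent, fixed on both sides, and still in
   [I]. *)
suff <- : u ** f = f by rewrite Iideal.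
apply: primitive_sub_idem.
- exact: RM.
- by rewrite mulA -(mulA f) fu -mulA uu.
- by rewrite -mulA fu.
- by rewrite mulA ff.
by apply: contra_neq u0 => uf; rewrite -uu -{2}fu -mulA uf mul0r.
Qed.

Local Notation fRspace := (linfun (hconv D f) @: R)%VS.

Let mem_fR x : (x \in fRspace) = (x \in R) && (f ** x == x).
Proof.
apply/memv_imgP/andP => [[y yR ->]|[xR /eqP fx]].
  by rewrite lfun_lin ?RM -?mulA ?ff //; exact: hconv_linr.
by exists x; rewrite // lfun_lin //; exact: hconv_linr.
Qed.

(** Left multiplication by [z] has an eigenvector in [f R]. The elements of [f R] killed by
    [z - c f] form a nonzero right ideal, so [f] is among them. *)
Lemma corner_scalar z : z \in R -> f ** z = z -> z ** f = z -> exists c, z = c *: f.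
Proof.
move=> zR fz zf.
have [c [v [vU v0 zv]]] : exists c v, [/\ v \in fRspace, v != 0 & z ** v = c *: v].
  apply: eigenvector_in; first exact: hconv_linr.
    by move=> v; rewrite !mem_fR => /andP [vR _]; rewrite RM // -mulA fz eqxx.
  apply: contra_neq f0 => U0; apply/eqP; rewrite -memv0 -U0 mem_fR fR ff.
  by rewrite eqxx.
exists c; apply/eqP; rewrite -subr_eq0 -zf -[f in c *: f]ff -mulZl -mulBl.
have linz : lin (hconv D (z - c *: f)) by exact: hconv_linr.
have : f \in (fRspace :&: lker (linfun (hconv D (z - c *: f))))%VS.
  have memI x : (x \in fRspace :&: lker (linfun (hconv D (z - c *: f))))%VS =
      [&& x \in R, f ** x == x & (z - c *: f) ** x == 0].
    by rewrite memv_cap mem_fR memv_ker lfun_lin // -andbA.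
  apply: right_ideal_contains.
  - by apply/subvP => x; rewrite memI => /andP [].
  - by move=> x; rewrite memI => /and3P [_ /eqP].
  - move=> x y; rewrite !memI => /and3P [xR /eqP fx /eqP zx] yR.
    by rewrite RM // -!mulA fx zx mul0r !eqxx.
  apply: contra_neq v0 => I0; apply/eqP; rewrite -memv0 -I0 memI.
  move: vU; rewrite mem_fR => /andP [-> /eqP fv] /=.
  by rewrite fv eqxx mulBl zv mulZl fv subrr eqxx.
by rewrite memv_cap memv_ker lfun_lin // => /andP [].
Qed.

Lemma dim_fH : (\dim (linfun (hconv D f) @: fullv)%VS)%:R = d%:R * t f.
Proof.
rewrite -tr_t; apply: dim_img_idempotent; first exact: hconv_linr.
by move=> p; rewrite -mulA ff.
Qed.

Lemma t_f_neq0 : t f != 0.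
Proof.
have : d%:R * t f != 0.
  rewrite -dim_fH (pcharf0P _).1 // dimv_eq0; apply: contra_neq f0 => U0.
  apply/eqP; rewrite -memv0 -U0; apply/memv_imgP; exists f; first exact: memvf.
  by rewrite lfun_lin ?ff //; exact: hconv_linr.
by rewrite mulf_eq0 negb_or => /andP [].
Qed.

Variable F : H.
Hypotheses (F_prim : central_primitive_idem D R F) (fF : f ** F = f).

Lemma trace_fR x : x \in R -> sub_trace fRspace (hconv D ^~ x) = t (F ** x) / t f.
Proof.
have tf0 := t_f_neq0; pose b := vbasis fRspace.
have bfR (i : 'I_(\dim fRspace)) : b`_i \in fRspace.
  by apply/vbasis_mem/mem_nth; rewrite size_tuple.
have bR (i : 'I_(\dim fRspace)) : b`_i \in R.
  by move: (bfR i); rewrite mem_fR => /andP [].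
have fb (i : 'I_(\dim fRspace)) : f ** b`_i = b`_i.
  by move: (bfR i); rewrite mem_fR => /andP [_ /eqP].
(* [v i] represents the [i]-th coordinate functional; the right factor [f] that puts it in [R f] is
   absorbed by cyclicity of [t]. *)
have /fin_all_exists [v vP] (i : 'I_(\dim fRspace)) : exists v, [/\ v \in R, v ** f = v &
    forall y, y \in R -> coord b i (f ** y) = t (y ** v)].
  have linphi : lin (fun y => coord b i (f ** y) : k^o).
    by move=> c y z; rewrite (hconv_linr D f) linearP.
  have [w wR wP] := t_represent linphi; exists (w ** f); split.
  - exact: RM.
  - by rewrite mulA ff.
  move=> y yR; rewrite -mulA tC -mulA -wP; last exact: RM.
  by rewrite -mulA ff.
have vR i : v i \in R by case: (vP i).
have vf i : v i ** f = v i by case: (vP i).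
have tv i y : y \in R -> t (y ** v i) = coord b i (f ** y).
  by move=> yR; case: (vP i) => _ _ ->.
(* The product lies in [f R f = k f], and applying [t] determines the scalar. *)
have bv (i j : 'I_(\dim fRspace)) : b`_j ** v i = ((j == i)%:R / t f) *: f.
  have [|||c cE] := @corner_scalar (b`_j ** v i).
  - exact: RM.
  - by rewrite -mulA fb.
  - by rewrite mulA vf.
  have := tv i _ (bR j); rewrite fb coord_free ?(basis_free (vbasisP _)) //.
  rewrite cE (linZ lint) => <-; congr (_ *: _).
  by rewrite -[_ *: _]/(c * t f) mulfK.
(* The factor [t f] undoes the denominator in [bv]: [P] becomes a right identity on [f R] and, by
   nondegeneracy, a left identity on [R f]. *)
pose P := t f *: \sum_i v i ** b`_i.
have PR : P \in R by apply: rpredZ; apply: rpred_sum => i _; exact: RM.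
have uP u : u \in R -> f ** u = u -> u ** P = u.
  move=> uR fu; have uU : u \in fRspace by rewrite mem_fR uR fu eqxx.
  rewrite (coord_vbasis uU) mul_suml; apply: eq_bigr => j _.
  rewrite mulZl; congr (_ *: _); rewrite /P mulZr mul_sumr (bigD1 j) //=.
  rewrite big1 => [|i ij]; last by rewrite -mulA bv eq_sym (negPf ij) GRing.mul0r scale0r mul0r.
  by rewrite addr0 -mulA bv eqxx mulZl fb scalerA mulrC -mulrA mulVf // mulr1 scale1r.
have Pu u : u \in R -> u ** f = u -> P ** u = u.
  move=> uR uf; apply/eqP; rewrite -subr_eq0; apply/eqP/t_nondeg => [|y yR].
    by rewrite rpredB ?RM.
  have gP : f ** y ** P = f ** y by rewrite uP ?RM // -mulA ff.
  have uy : u ** y = u ** (f ** y) by rewrite -mulA uf.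
  rewrite mulBl -scaleN1r (linD lint) (linZ lint) mulA uy tC mulA gP.
  by rewrite scaleN1r subrr.
have vF i : v i ** b`_i ** F = v i ** b`_i.
  have bF : b`_i ** F = b`_i.
    have [_ _ _ FC _] := F_prim.
    by rewrite -(FC _ (bR i)) -[in LHS](fb i) -mulA (FC _ fR) fF fb.
  by rewrite mulA bF.
have PF : P ** F = P.
  by rewrite /P mulZl mul_suml; congr (_ *: _); apply: eq_bigr => i _.
(* Both products equal [P ** y ** P], as [P] is a sum of terms from [R f] times [f R]. *)
have PC y : y \in R -> P ** y = y ** P.
  move=> yR; transitivity (P ** (y ** P)).
    rewrite -mulA {1 2}/P !mulZl; congr (_ *: _).
    rewrite !mul_suml; apply: eq_bigr => i _.
    by rewrite !(mulA (v i)) uP ?RM // -mulA fb.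
  rewrite {2 3}/P !mulZr; congr (_ *: _); rewrite !mul_sumr; apply: eq_bigr => i _.
  by rewrite -!(mulA y) -(mulA P) Pu ?RM // mulA vf.
have PP : P ** P = P.
  rewrite {1 3}/P !mulZl !mul_suml; congr (_ *: _); apply: eq_bigr => i _.
  by rewrite mulA uP.
have P0 : P != 0.
  apply: contra_neq f0 => P0; by rewrite -(Pu f fR ff) P0 mul0r.
(* [P] is a nonzero central idempotent below [F]; otherwise [F = P + (F - P)] would contradict
   primitivity. *)
have PFE : P = F.
  have [FR F0 FF FC Fprim] := F_prim.
  have FP : F ** P = P by rewrite FC.
  apply/eqP; rewrite eq_sym -subr_eq0; apply: contraT => FP0.
  case: (Fprim P (F - P)) => //.
  - by rewrite rpredB.
  - by rewrite /idem mulBl !mulBr FF FP PF PP subrr subr0.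
  - by move=> y yR; rewrite mulBl mulBr FC // PC.
  - by rewrite mulBr PF PP subrr.
  - by rewrite mulBl FP PP subrr.
  by rewrite addrC subrK.
rewrite -PFE /P mulZl (linZ lint) -[_ *: _]/(_ * _) mulrC mulKf // mul_suml.
transitivity (\sum_i t (v i ** b`_i ** x)); last by rewrite (lin_sum lint).
rewrite /sub_trace; apply: eq_bigr => i _.
by rewrite mulA tC tv ?RM // -mulA fb.
Qed.

End PrimitiveIdempotent.


Theorem theorem2p1
  (k : closedFieldType) (char0 : [pchar k] =i pred0)
  (d : nat) (D : hopf_data k d)
  (hopfD : is_hopf D) (ssD : semisimple D)
  (* V_0, ..., V_{n-1}: the non-isomorphic irreducible left H-modules *)
  (n : nat) (dV : 'I_n -> nat) (V : forall i : 'I_n, 'I_d -> 'M[k]_(dV i))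
  (V_irr : forall i, is_lmod D (V i) /\ lmod_irreducible (V i))
  (V_noniso : forall i j, lmod_iso (V i) (V j) -> i = j)
  (V_all : forall m (rho : 'I_d -> 'M[k]_m),
      is_lmod D rho -> lmod_irreducible rho -> exists i, lmod_iso rho (V i))
  (* integrals, normalized *)
  (Lam lam : 'rV[k]_d)
  (Lam_int : is_integral_H D Lam) (lam_int : is_integral_Hdual D lam)
  (lamLam : hpair lam Lam = 1)
  (lam1 : hpair lam (hunit D) = d%:R) (* i.e. F_0 = lam/d is idempotent *)
  (F f : 'rV[k]_d) :
  let RH := (<<[seq hchar (V i) | i : 'I_n]>>)%VS in
  central_primitive_idem D RH F ->
  primitive_idem D RH f ->
  hconv D f F = f ->
  let fRH := (linfun (hconv D f) @: RH)%VS in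
  let fHd := (linfun (hconv D f) @: fullv)%VS in
  let C := hit D Lam (d%:R *: F) in
  let eta := (\dim fHd)%:R^-1 *: C in
  (forall x, x \in RH -> sub_trace fRH (fun y => hconv D y x) = hpair x eta)
  /\ hpair (hcounit D) eta = (\dim fRH)%:R.
Proof.
move=> RH F_prim f_prim fF fRH fHd C eta.
have d_neq0 := natf_d_neq0 char0 lamLam.
have tC := hconv_LamC char0 hopfD ssD Lam_int lam_int lamLam lam1.
have tr_t := tr_hconv char0 hopfD ssD Lam_int lam_int lamLam lam1.
have R1 := RH_hcounit hopfD V_all.
have RM x y : x \in RH -> y \in RH -> hconv D x y \in RH.
  exact: (RH_hconv hopfD V_irr V_all).
have nondeg x := RH_nondegenerate char0 hopfD ssD Lam_int lam_int lamLam lam1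
  V_irr V_noniso V_all (x := x).
have traceE x : x \in RH -> sub_trace fRH (fun y => hconv D y x) = hpair x eta.
  move=> xR; rewrite (trace_fR char0 hopfD RM tC tr_t nondeg d_neq0 f_prim F_prim fF xR).
  (* The dimension in [eta] is [d] times the value of [f] at [Lam], so the factor [d] of [C]
     cancels. *)
  rewrite /eta hpairZr /C hpair_hit (dim_fH hopfD tr_t f_prim).
  by rewrite (linZ (hconv_linl D x)) hpairZl invfM mulrACA mulVf // mul1r mulrC.
(* The counit is the unit of [H^*] and lies in [RH]; its trace is that of the identity. *)
split=> //; rewrite -traceE //; apply: sub_trace_id => x _.
exact: hconv1r.
Qed.
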